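(* Let $A$ be the generator of a $C_0$-semigroup on a complex Hilbert space $H$. The following are equivalent: (i) The growth bound of the semigroup satisfies $\omega(A)<0$. (ii) There exists a number $\eta>0$ with the following property: for each $x\in\operatorname{dom}(A)$ of norm $\|x\|_H=1$ there is a vector $y\in H$ of norm $\|y\|_H=1$ which satisfies $$ \operatorname{Re}\big((y|x)\,(Ax|y)\big)\le-\eta. $$
   Context: $(\cdot|\cdot)$ denotes the inner product of $H$ (linear in the first argument). The growth bound of the $C_0$-semigroup $(e^{tA})_{t\ge0}$ generated by $A$ is $\omega(A):=\inf\{\omega\in\mathbb{R}:\exists M\ge1\ \forall t\ge0\ \|e^{tA}\|\le Me^{t\omega}\}\in[-\infty,\infty)$. No positivity or order structure is assumed. *)

(* Defs.v *)
From Stdlib Require Import Reals.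
From Coquelicot Require Import Coquelicot.
Open Scope R_scope.

(* A complex Hilbert space: a Banach space over [C] whose norm comes from an
   inner product.  Linearity is in the first argument; positive definiteness
   of [inner] follows from [inner_norm]. *)
Record HilbertSpace := {
  hilbert_space :> CompleteNormedModule C_AbsRing;
  inner : hilbert_space -> hilbert_space -> C;
  inner_plus_l : forall x y z : hilbert_space,
    inner (plus x y) z = Cplus (inner x z) (inner y z);
  inner_scal_l : forall (c : C) (x y : hilbert_space),
    inner (scal c x) y = Cmult c (inner x y);
  inner_conj : forall x y : hilbert_space, inner y x = Cconj (inner x y);
  inner_norm : forall x : hilbert_space, inner x x = RtoC (norm x ^ 2)
}.

Arguments inner {h} _ _.

(* The values [T t] for [t < 0] are irrelevant throughout.  [is_linear] is
   Coquelicot's notion of a bounded linear operator. *)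
Record is_C0_semigroup {H : HilbertSpace} (T : R -> H -> H) : Prop := {
  C0_bounded_linear : forall t, 0 <= t -> is_linear (T t);
  C0_zero : forall x, T 0 x = x;
  C0_add : forall s t x, 0 <= s -> 0 <= t -> T (s + t) x = T s (T t x);
  C0_continuous : forall x, filterlim (fun t => T t x) (at_right 0) (locally x)
}.

Definition generator_graph {H : HilbertSpace} (T : R -> H -> H) (x y : H) : Prop :=
  filterlim (fun t => scal (RtoC (/ t)) (minus (T t x) x)) (at_right 0) (locally y).

(* An unbounded operator is a domain together with a function on [H] whose
   values outside the domain carry no meaning. *)
Record is_generator {H : HilbertSpace} (dom : H -> Prop) (A : H -> H)
    (T : R -> H -> H) : Prop := {
  generator_dom : forall x, dom x <-> exists y, generator_graph T x y;
  generator_val : forall x, dom x -> generator_graph T x (A x)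
}.

(* Least upper bound in the extended reals, so that no finiteness has to be
   assumed. *)
Definition op_norm {H : HilbertSpace} (L : H -> H) : Rbar :=
  Lub_Rbar (fun r => exists x : H, norm x <= 1 /\ r = norm (L x)).

Definition growth_bound {H : HilbertSpace} (T : R -> H -> H) : Rbar :=
  Glb_Rbar (fun w => exists M : R, 1 <= M /\
    forall t, 0 <= t -> Rbar_le (op_norm (T t)) (M * exp (t * w))).

(* Main.v *)
Require Import Defs.
From Stdlib Require Import Reals Lra Lia ssreflect Classical IndefiniteDescription.
From Coquelicot Require Import Coquelicot.
Open Scope R_scope.

(** Both conditions are equivalent to a lower bound for [lam - A] on the closed
    right half-plane.

    If the numerical condition holds, then testing [(A - lam) x] with the given [y] yields
    [eta |x| <= |(lam - A) x|] for [Re lam >= 0], by Cauchy-Schwarz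
    ([half_plane_bound_of_numerical]). That such a bound forces exponential
    decay is the theorem of Gearhart and Pruess. It is proved here by an energy
    estimate: Plancherel's identity gives
    [eta^2 * int |f|^2 <= int |f' - A f|^2] for functions [f] of compact support,
    also with a damping factor [exp (- 2 alpha t)], [alpha >= 0]; for
    [f t = phi t *: T t x] with a real function [phi] the right-hand side is
    [int phi'^2 |T t x|^2]. The choice [phi t = exp (eta t / 2)], cut off near 0
    and frozen at late times, lets a fixed fraction of the left-hand side
    survive and improves the growth rate by a fixed amount
    ([growth_rate_improvement]). This works from every rate that is not
    negative, so after finitely many improvements the rate is negative
    ([half_plane_bound_decay]).

    To avoid vector-valued Fourier integrals, time is discretised with step
    [1 / n] and Plancherel's identity is that of the finite Fourier transform
    ([plancherel]). The backward difference quotient has its spectrum in the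
    closed right half-plane, so that the bound for [lam - A] applies to every
    frequency without any loss ([discrete_energy_bound]); the step length tends
    to 0 only in the resulting scalar inequality ([damped_bound_on_domain]). Two
    general facts enter: an exponential bound for some rate, from the uniform
    boundedness principle ([semigroup_exp_bound]), and the density of the domain
    ([dom_dense]).

    Conversely, if the semigroup decays, then a Neumann series gives
    [(Re lam + e / 2) |x| <= M |(lam - A) x|] ([resolvent_bound_of_decay]). For
    fixed [x] the form [y |-> Re ((y|x) (A x|y))] has rank at most two, an
    eigenvector for its smallest eigenvalue is explicit, and the bound at a
    suitable [lam] keeps that eigenvalue away from 0 ([numerical_of_decay]). *)

(** * Inner products and norms *)

(** The explicit carriers keep every vector expression at the type of the
    Hilbert space, whatever canonical structure its operands come from. *)
Declare Scope vec_scope.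
Delimit Scope vec_scope with V.
Notation "x + y" := (@plus (CompleteNormedModule.AbelianMonoid C_AbsRing
  (hilbert_space _)) x y : hilbert_space _) : vec_scope.
Notation "x - y" := (@minus (CompleteNormedModule.AbelianGroup C_AbsRing
  (hilbert_space _)) x y : hilbert_space _) : vec_scope.
Notation "- x" := (@opp (CompleteNormedModule.AbelianGroup C_AbsRing
  (hilbert_space _)) x : hilbert_space _) : vec_scope.
Notation "c *: x" := (@scal C_Ring (CompleteNormedModule.ModuleSpace C_AbsRing
  (hilbert_space _)) c%C x : hilbert_space _)
  (at level 40, x at level 40) : vec_scope.
Notation vzero := (@zero (CompleteNormedModule.AbelianMonoid C_AbsRing
  (hilbert_space _)) : hilbert_space _).

Section Hilbert.
Context {H : HilbertSpace}.
Implicit Types x y z : H.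

Lemma inner_zero_l z : inner (zero : H) z = RtoC 0.
Proof.
  have E := inner_plus_l _ (zero : H) zero z.
  rewrite plus_zero_r in E.
  apply (f_equal (fun c => Cminus c (inner (zero : H) z))) in E.
  ring_simplify in E. symmetry. exact E.
Qed.

Lemma inner_opp_l x z : inner (opp x) z = Copp (inner x z).
Proof.
  have E := inner_plus_l _ x (opp x) z.
  rewrite plus_opp_r inner_zero_l in E.
  replace (inner (opp x) z)
    with (Cminus (Cplus (inner x z) (inner (opp x) z)) (inner x z)) by ring.
  rewrite -E. ring.
Qed.

Lemma inner_minus_l x y z : inner (minus x y) z = Cminus (inner x z) (inner y z).
Proof. by rewrite inner_plus_l inner_opp_l. Qed.

Lemma inner_plus_r x y z : inner z (plus x y) = Cplus (inner z x) (inner z y).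
Proof.
  rewrite inner_conj inner_plus_l (inner_conj _ x z) (inner_conj _ y z).
  apply injective_projections; simpl; ring.
Qed.

Lemma inner_scal_r (c : C) x z : inner z (scal c x) = Cmult (Cconj c) (inner z x).
Proof.
  rewrite inner_conj inner_scal_l (inner_conj _ x z).
  apply injective_projections; simpl; ring.
Qed.

Lemma inner_opp_r x z : inner z (opp x) = Copp (inner z x).
Proof.
  rewrite inner_conj inner_opp_l (inner_conj _ x z).
  apply injective_projections; simpl; ring.
Qed.

Lemma inner_zero_r z : inner z (zero : H) = RtoC 0.
Proof.
  rewrite inner_conj inner_zero_l.
  apply injective_projections; simpl; ring.
Qed.

Lemma inner_ext x y : (forall z, inner x z = inner y z) -> x = y.
Proof.
  move=> E.
  have D : (minus x y : H) = zero.
  { refine (norm_eq_zero (minus x y : H) _).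
    have Q := inner_norm _ (minus x y).
    rewrite inner_minus_l E in Q.
    apply (f_equal fst) in Q. simpl in Q. nra. }
  apply (plus_reg_r (opp y)). by rewrite plus_opp_r -D.
Qed.

End Hilbert.

(** Identities between linear combinations of vectors are checked by pairing
    both sides with an arbitrary vector, which turns them into identities in
    the field [C]. *)
Ltac expand_inner :=
  rewrite /minus ?(inner_plus_l, inner_opp_l, inner_scal_l, inner_zero_l,
    inner_plus_r, inner_opp_r, inner_scal_r, inner_zero_r).
Ltac vec_ring := apply inner_ext => ?; expand_inner; ring.
Ltac vec_field := apply inner_ext => ?; expand_inner; field.

Section HilbertNorm.
Context {H : HilbertSpace}.
Implicit Types x y z : H.

Lemma norm_sqr_inner x : norm x ^ 2 = Re (inner x x).
Proof. by rewrite inner_norm. Qed.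

Lemma norm_sqr_plus x y :
  norm (x + y)%V ^ 2 = norm x ^ 2 + norm y ^ 2 + 2 * Re (inner x y).
Proof.
  rewrite !norm_sqr_inner. expand_inner.
  rewrite (inner_conj _ x y). unfold Re. simpl. ring.
Qed.

Lemma norm_scal_eq (c : C) x : norm (c *: x)%V = Cmod c * norm x.
Proof.
  apply Rsqr_inj.
  - apply norm_ge_0.
  - apply Rmult_le_pos; [apply Cmod_ge_0 | apply norm_ge_0].
  - rewrite !Rsqr_pow2 norm_sqr_inner Rpow_mult_distr. expand_inner.
    rewrite inner_norm. unfold Cmod. rewrite pow2_sqrt; last nra.
    unfold Re. simpl. ring.
Qed.

Lemma norm_plus_le x y : norm (x + y)%V <= norm x + norm y.
Proof. exact (norm_triangle x y). Qed.

(** Read off from the triangle inequality for [x + y]. *)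
Lemma re_inner_le x y : Re (inner x y) <= norm x * norm y.
Proof.
  have E := norm_sqr_plus x y. have L := norm_plus_le x y.
  have P := norm_ge_0 (x + y)%V. nra.
Qed.

(** The real part suffices after [y] has been rotated by the phase of
    [inner x y]. *)
Lemma cauchy_schwarz x y : Cmod (inner x y) <= norm x * norm y.
Proof.
  have L := re_inner_le x (inner x y *: y)%V.
  rewrite inner_scal_r norm_scal_eq in L.
  have E : Re (Cmult (Cconj (inner x y)) (inner x y)) = Cmod (inner x y) ^ 2.
  { unfold Cmod. rewrite pow2_sqrt; last nra. unfold Re. simpl. ring. }
  rewrite E in L.
  have P := Cmod_ge_0 (inner x y).
  have Px := norm_ge_0 x. have Py := norm_ge_0 y.
  destruct (Req_dec (Cmod (inner x y)) 0) as [Z|Z]; [rewrite Z; nra|].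
  apply (Rmult_le_reg_l (Cmod (inner x y))); nra.
Qed.

Lemma filterlim_norm_iff {U : Type} (F : (U -> Prop) -> Prop) {FF : Filter F}
    (f : U -> H) (y : H) :
  filterlim f F (locally y) <->
  forall eps, 0 < eps -> F (fun t => norm (f t - y)%V < eps).
Proof.
  split.
  - move=> L eps He.
    apply (L (fun z => norm (z - y)%V < eps)).
    apply: (locally_le_locally_norm y). by exists (mkposreal eps He).
  - move=> L P HP. case: (locally_norm_le_locally y _ HP) => e He.
    rewrite /filtermap. apply: filter_imp (L e (cond_pos e)) => t Ht. by apply: He.
Qed.

Lemma at_right_0_iff (P : R -> Prop) :
  at_right 0 P <-> exists d, 0 < d /\ forall t, 0 < t < d -> P t.
Proof.
  split.
  - intros [d Hd]. exists d. split; [apply cond_pos|]. intros t Ht. apply Hd; [|lra].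
    change (Rabs (t + - 0) < d). rewrite Ropp_0 Rplus_0_r Rabs_pos_eq; lra.
  - intros [d [Hd K]]. exists (mkposreal d Hd). intros t Ht Ht0.
    apply K. split; [exact Ht0|].
    change (Rabs (t + - 0) < d) in Ht.
    rewrite Ropp_0 Rplus_0_r Rabs_pos_eq in Ht; lra.
Qed.

Lemma lim_at_right_iff (f : R -> H) (y : H) :
  filterlim f (at_right 0) (locally y) <->
  forall eps, 0 < eps ->
    exists d, 0 < d /\ forall t, 0 < t < d -> norm (f t - y)%V < eps.
Proof.
  rewrite filterlim_norm_iff.
  split; intros L eps He; apply at_right_0_iff, L, He.
Qed.

Lemma norm_minus_sym x y : norm (x - y)%V = norm (y - x)%V.
Proof. rewrite -norm_opp. f_equal. vec_ring. Qed.

Lemma norm_minus_triangle x y z :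
  norm (x - z)%V <= norm (x - y)%V + norm (y - z)%V.
Proof.
  have -> : (x - z = (x - y) + (y - z))%V by vec_ring.
  apply norm_plus_le.
Qed.

Lemma Cmod_RtoC (r : R) : 0 <= r -> Cmod (RtoC r) = r.
Proof. intros. rewrite Cmod_R. by apply Rabs_pos_eq. Qed.

End HilbertNorm.

(** * Plancherel's identity for the finite Fourier transform *)

Notation vsum := (@sum_n (CompleteNormedModule.AbelianMonoid C_AbsRing
  (hilbert_space _))).

Definition cis (t : R) : C := (cos t, sin t).

Lemma cis_plus s t : cis (s + t) = Cmult (cis s) (cis t).
Proof. unfold cis, Cmult; simpl. rewrite cos_plus sin_plus. f_equal; ring. Qed.

Lemma cis_0 : cis 0 = RtoC 1.
Proof. unfold cis. by rewrite cos_0 sin_0. Qed.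

Lemma Cmod_cis t : Cmod (cis t) = 1.
Proof.
  unfold Cmod, cis. simpl fst. simpl snd. rewrite -sqrt_1. f_equal.
  have := sin2_cos2 t. unfold Rsqr. lra.
Qed.

Lemma cis_conj t : Cconj (cis t) = cis (- t).
Proof. unfold cis, Cconj; simpl. by rewrite cos_neg sin_neg. Qed.

Lemma cis_full_turns (m : nat) : cis (2 * PI * INR m) = RtoC 1.
Proof.
  unfold cis. replace (2 * PI * INR m) with (0 + 2 * INR m * PI) by ring.
  by rewrite cos_period sin_period cos_0 sin_0.
Qed.

Lemma cis_neq_1 t : 0 < t < 2 * PI -> cis t <> RtoC 1.
Proof.
  intros Ht E. apply (f_equal fst) in E. simpl in E.
  replace t with (2 * (t / 2)) in E by field.
  rewrite cos_2a_sin in E.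
  have := sin_gt_0 (t / 2). nra.
Qed.

Definition root_angle (N : nat) : R := 2 * PI / INR (S N).

Lemma root_angle_mult N : INR (S N) * root_angle N = 2 * PI.
Proof. unfold root_angle. field. apply not_0_INR. lia. Qed.

Ltac real_ring := match goal with |- @eq _ ?a ?b => change (@eq R a b) end; ring.

Lemma rsum_mult (c : R) (f : nat -> R) N :
  sum_n (fun j => c * f j) N = c * sum_n f N.
Proof. exact (sum_n_mult_l (K := R_Ring) c f N). Qed.

Lemma rsum_plus (f g : nat -> R) N :
  sum_n (fun j => f j + g j) N = sum_n f N + sum_n g N.
Proof. exact (sum_n_plus (G := R_AbelianMonoid) f g N). Qed.

Lemma rsum_Sn (f : nat -> R) N : sum_n f (S N) = sum_n f N + f (S N).
Proof. exact (sum_Sn (G := R_AbelianMonoid) f N). Qed.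

Lemma rsum_le (f g : nat -> R) N :
  (forall k, (k <= N)%nat -> f k <= g k) -> sum_n f N <= sum_n g N.
Proof.
  induction N as [|N IH]; intros L; [rewrite !sum_O; by apply: L|].
  rewrite !rsum_Sn. apply: Rplus_le_compat; [apply: IH => k Hk|]; apply: L; lia.
Qed.

Section Plancherel.
Context {H : HilbertSpace}.

(** The sum is invariant under multiplication by [cis (root_angle N * d)],
    which differs from 1. *)
Lemma vsum_roots_zero (N d : nat) (a : H) : (0 < d <= N)%nat ->
  vsum (fun j => cis (INR j * INR d * root_angle N) *: a)%V N = vzero.
Proof.
  intros Hd.
  set w := cis (INR d * root_angle N).
  have T : forall n, (w *: vsum (fun j => cis (INR j * INR d * root_angle N) *: a) n =
     vsum (fun j => cis (INR j * INR d * root_angle N) *: a) n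
       + (cis (INR (S n) * INR d * root_angle N) *: a - a))%V.
  { elim=> [|n IH].
    - rewrite !sum_O. simpl INR. rewrite !Rmult_0_l Rmult_1_l cis_0 -/w. vec_ring.
    - rewrite !sum_Sn.
      have -> : forall u v : H, (w *: (u + v) = w *: u + w *: v)%V by move=> u v; vec_ring.
      rewrite IH (S_INR (S n)).
      have -> : (INR (S n) + 1) * INR d * root_angle N
        = INR (S n) * INR d * root_angle N + INR d * root_angle N by ring.
      rewrite cis_plus -/w. vec_ring. }
  have E := T N.
  have -> : vsum (fun j => cis (INR j * INR d * root_angle N) *: a)%V N
    = (/ (w - 1) *: (w *: vsum (fun j => cis (INR j * INR d * root_angle N) *: a)%V N
         - vsum (fun j => cis (INR j * INR d * root_angle N) *: a)%V N))%V.
  { vec_field. apply Cminus_eq_contra. apply: cis_neq_1.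
    have P := PI_RGT_0.
    have A : root_angle N > 0 by apply: Rdiv_lt_0_compat; [lra | apply: lt_0_INR; lia].
    have := root_angle_mult N.
    have : 1 <= INR d by apply: (le_INR 1); lia.
    have : INR d + 1 <= INR (S N) by rewrite -S_INR; apply: le_INR; lia.
    nra. }
  rewrite E.
  have -> : INR (S N) * INR d * root_angle N = 2 * PI * INR d.
  { have := root_angle_mult N. nra. }
  rewrite cis_full_turns. vec_ring.
Qed.

(** Multiplying by the conjugate character of index [m] cancels every sum of
    characters of smaller index. *)
Lemma vsum_roots_orthogonal (N m n : nat) (a : nat -> H) : (n < m <= N)%nat ->
  vsum (fun j => cis (- (INR j * INR m * root_angle N)) *:
      vsum (fun k => cis (INR j * INR k * root_angle N) *: a k) n)%V N = vzero.
Proof.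
  intros Hm.
  (* the frequency [k - m] is congruent to the positive one [N + 1 + k - m] *)
  have E : forall k j, (k < m)%nat ->
    Cmult (cis (- (INR j * INR m * root_angle N))) (cis (INR j * INR k * root_angle N))
    = cis (INR j * INR (S N + k - m) * root_angle N).
  { intros k j Hk. rewrite -cis_plus minus_INR; last lia. rewrite plus_INR.
    have -> : INR j * (INR (S N) + INR k - INR m) * root_angle N
      = 2 * PI * INR j + (- (INR j * INR m * root_angle N) + INR j * INR k * root_angle N).
    { rewrite -(root_angle_mult N). ring. }
    rewrite [in RHS]cis_plus cis_full_turns. ring. }
  induction n as [|n IH].
  - rewrite -(vsum_roots_zero N (S N + 0 - m) (a 0%nat)); last lia.
    apply sum_n_ext => j. rewrite sum_O -E; last lia. vec_ring.
  - rewrite -[RHS](plus_zero_r (G := CompleteNormedModule.AbelianMonoid C_AbsRing H)).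
    rewrite -[X in plus X _]IH; last lia.
    rewrite -[X in plus _ X](vsum_roots_zero N (S N + S n - m) (a (S n))); last lia.
    rewrite -sum_n_plus. apply sum_n_ext => j.
    rewrite sum_Sn -E; last lia. vec_ring.
Qed.

Lemma re_inner_vsum (f : nat -> H) (a : H) N :
  sum_n (fun j => Re (inner (f j) a)) N = Re (inner (vsum f N) a).
Proof.
  induction N as [|N IH]; [by rewrite !sum_O|].
  rewrite !sum_Sn IH inner_plus_l. reflexivity.
Qed.

(** The vectors are added one after the other; summed over all [j], the new
    contribution is orthogonal to what is already there. *)
Lemma plancherel (N : nat) (a : nat -> H) :
  sum_n (fun j => norm (vsum (fun k => cis (INR j * INR k * root_angle N) *: a k)%V N) ^ 2) N
  = INR (S N) * sum_n (fun k => norm (a k) ^ 2) N.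
Proof.
  have P : forall n, (n <= N)%nat ->
    sum_n (fun j => norm (vsum (fun k => cis (INR j * INR k * root_angle N) *: a k)%V n) ^ 2) N
    = INR (S N) * sum_n (fun k => norm (a k) ^ 2) n; last by apply: P.
  induction n as [|n IH]; intros Hn.
  - rewrite sum_O -sum_n_const. apply sum_n_ext => j.
    by rewrite sum_O norm_scal_eq Cmod_cis Rmult_1_l.
  - set F := fun j => vsum (fun k => cis (INR j * INR k * root_angle N) *: a k)%V n.
    set e := fun j => (cis (INR j * INR (S n) * root_angle N) *: a (S n))%V.
    have Z : sum_n (fun j => Re (inner (F j) (e j))) N = 0.
    { have O := vsum_roots_orthogonal N (S n) n a ltac:(lia).
      apply (f_equal (fun v => Re (inner v (a (S n))))) in O.
      rewrite inner_zero_l -re_inner_vsum in O.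
      rewrite -[RHS]O. apply sum_n_ext => j.
      by rewrite /e inner_scal_r cis_conj inner_scal_l. }
    transitivity (sum_n (fun j => norm (F j) ^ 2 + norm (a (S n)) ^ 2
      + 2 * Re (inner (F j) (e j))) N).
    { apply sum_n_ext => j. rewrite sum_Sn norm_sqr_plus -/(F j) -/(e j).
      by rewrite [norm (e j)]norm_scal_eq Cmod_cis Rmult_1_l. }
    rewrite !rsum_plus rsum_mult Z sum_n_const IH; last lia.
    rewrite rsum_Sn. real_ring.
Qed.

End Plancherel.

(** * The discrete energy bound *)

Record is_linear_on {H : HilbertSpace} (dom : H -> Prop) (A : H -> H) : Prop := {
  dom_plus : forall x y : H, dom x -> dom y -> dom (x + y)%V;
  dom_scal : forall (c : C) (x : H), dom x -> dom (c *: x)%V;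
  op_plus : forall x y : H, dom x -> dom y -> A (x + y)%V = (A x + A y)%V;
  op_scal : forall (c : C) (x : H), dom x -> A (c *: x)%V = (c *: A x)%V
}.

Definition half_plane_bound {H : HilbertSpace} (dom : H -> Prop) (A : H -> H)
    (eta : R) : Prop :=
  forall (lam : C) (x : H), 0 <= Re lam -> dom x ->
    eta * norm x <= norm (lam *: x - A x)%V.

Section Difference.
Context {H : HilbertSpace} (dom : H -> Prop) (A : H -> H) (lin : is_linear_on dom A).

(** The residue at step [k + 1] of the implicit Euler scheme for [u' = A u]. *)
Definition euler_residue (h : R) (f : nat -> H) (k : nat) : H :=
  (RtoC (/ h) *: (f (S k) - f k) - A (f (S k)))%V.

Lemma dom_vsum (c : nat -> C) (f : nat -> H) n : (forall k, dom (f k)) ->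
  dom (vsum (fun k => c k *: f k)%V n).
Proof.
  intros Hf. induction n as [|n IH].
  - rewrite sum_O. by apply: (dom_scal _ _ lin).
  - rewrite sum_Sn. apply: (dom_plus _ _ lin) => //. by apply: (dom_scal _ _ lin).
Qed.

(** Summation by parts. In the application [zeta k] is [z ^ k] up to the
    factorisation of [z] into modulus and phase, and [f (S n)] vanishes, so that
    both sums on the right coincide. *)
Lemma transform_euler_residue (h : R) (z : C) (zeta : nat -> C) (f : nat -> H) n :
  0 < h -> zeta 0%nat = RtoC 1 -> (forall k, zeta (S k) = Cmult (zeta k) z) ->
  (forall k, dom (f k)) -> f 0%nat = vzero ->
  (z *: vsum (fun k => zeta k *: euler_residue h f k) n
   = RtoC (/ h) *: (vsum (fun k => zeta k *: f k) (S n) - z *: vsum (fun k => zeta k *: f k) n)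
     - A (vsum (fun k => zeta k *: f k) (S n)))%V.
Proof.
  intros Hh Z0 ZS Hf F0.
  have A0 : A vzero = vzero.
  { rewrite -F0. have -> : (f 0%nat = RtoC 0 *: f 0%nat)%V by rewrite F0; vec_ring.
    rewrite (op_scal _ _ lin) //. vec_ring. }
  induction n as [|n IH].
  - rewrite sum_Sn !sum_O ZS Z0 F0.
    have -> : (RtoC 1 *: vzero + (RtoC 1 * z) *: f 1%nat = z *: f 1%nat)%V by vec_ring.
    rewrite (op_scal _ _ lin) // /euler_residue F0. vec_ring.
  - rewrite sum_Sn [in RHS]sum_Sn.
    rewrite (op_plus _ _ lin); [| by apply: dom_vsum | by apply: (dom_scal _ _ lin)].
    rewrite (op_scal _ _ lin) //.
    have -> : forall u v : H, (z *: (u + v) = z *: u + z *: v)%V by move=> u v; vec_ring.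
    rewrite IH /euler_residue (ZS (S n)).
    rewrite [in RHS](sum_Sn (fun k => zeta k *: f k)%V n).
    rewrite [in LHS](sum_Sn (fun k => zeta k *: f k)%V n).
    vec_ring.
Qed.

(** The discrete Fourier transform turns the backward difference quotient
    [(f k - f (k - 1)) / h] into multiplication by [(1 - z) / h]. All these
    numbers lie in the closed right half-plane because [Cmod z = r <= 1], so
    the bound applies to every Fourier coefficient and Plancherel's identity
    carries it over to [f]. *)
Lemma discrete_energy_bound (eta h r : R) (f : nat -> H) (N : nat) :
  half_plane_bound dom A eta -> 0 < eta -> 0 < h -> 0 < r <= 1 ->
  (forall k, dom (f k)) -> f 0%nat = vzero -> f (S N) = vzero ->
  eta ^ 2 * sum_n (fun k => (r ^ k) ^ 2 * norm (f k) ^ 2) N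
  <= sum_n (fun k => (r ^ k) ^ 2 * norm (euler_residue h f k) ^ 2) N.
Proof.
  intros B Heta Hh Hr Hf F0 FN.
  have rk : forall k, 0 < r ^ k by move=> k; apply: pow_lt; lra.
  have W : forall g : nat -> H, sum_n (fun k => (r ^ k) ^ 2 * norm (g k) ^ 2) N
    = / INR (S N) * sum_n (fun j => norm (vsum (fun k =>
        (cis (INR j * INR k * root_angle N) * RtoC (r ^ k)) *: g k)%V N) ^ 2) N.
  { move=> g.
    transitivity (sum_n (fun k => norm (RtoC (r ^ k) *: g k)%V ^ 2) N).
    - apply: sum_n_ext => k. rewrite norm_scal_eq Cmod_RtoC; first real_ring.
      by apply: Rlt_le.
    - have P := plancherel N (fun k => RtoC (r ^ k) *: g k)%V.
      transitivity (/ INR (S N) * (INR (S N) * sum_n (fun k => norm (RtoC (r ^ k) *: g k)%V ^ 2) N)).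
      + rewrite -Rmult_assoc Rinv_l; last by apply: not_0_INR. by rewrite Rmult_1_l.
      + rewrite -P. f_equal. apply: sum_n_ext => j. do 2 f_equal.
        apply: sum_n_ext => k. vec_ring. }
  rewrite !W.
  have PN : 0 < / INR (S N) by apply: Rinv_0_lt_compat; apply: lt_0_INR; lia.
  rewrite -Rmult_assoc (Rmult_comm (eta ^ 2)) Rmult_assoc.
  apply: Rmult_le_compat_l; first lra.
  rewrite -rsum_mult.
  apply: rsum_le => j _.
  set zeta := fun k => Cmult (cis (INR j * INR k * root_angle N)) (RtoC (r ^ k)).
  set z := Cmult (cis (INR j * root_angle N)) (RtoC r).
  have Z0 : zeta 0%nat = RtoC 1.
  { rewrite /zeta. simpl INR. rewrite Rmult_0_r Rmult_0_l cis_0 pow_O. ring. }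
  have ZS : forall k, zeta (S k) = Cmult (zeta k) z.
  { move=> k. rewrite /zeta /z S_INR.
    have -> : INR j * (INR k + 1) * root_angle N
      = INR j * INR k * root_angle N + INR j * root_angle N by ring.
    rewrite cis_plus -tech_pow_Rmult RtoC_mult. ring. }
  have E := transform_euler_residue h z zeta f N Hh Z0 ZS Hf F0.
  rewrite sum_Sn FN in E.
  have Fe : (vsum (fun k => zeta k *: f k) N + zeta (S N) *: vzero
    = vsum (fun k => zeta k *: f k) N)%V by vec_ring.
  rewrite Fe in E.
  have Mz : Cmod z = r by rewrite /z Cmod_mult Cmod_cis Cmod_RtoC; lra.
  have L := B (Cmult (RtoC (/ h)) (Cminus (RtoC 1) z)) (vsum (fun k => zeta k *: f k)%V N).
  have L' : eta * norm (vsum (fun k => zeta k *: f k)%V N)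
    <= r * norm (vsum (fun k => zeta k *: euler_residue h f k)%V N).
  { rewrite -Mz -norm_scal_eq E. eapply Rle_trans; first apply: L.
    - have Rz : Re z <= 1.
      { apply: Rle_trans (Rle_abs _) _. apply: Rle_trans (re_le_Cmod z) _. lra. }
      have Hi := Rinv_0_lt_compat h Hh.
      have -> : Re (Cmult (RtoC (/ h)) (Cminus (RtoC 1) z)) = / h * (1 - Re z).
      { rewrite /Re /=. ring. }
      apply: Rmult_le_pos; lra.
    - by apply: dom_vsum.
    - apply: Req_le. f_equal. vec_ring. }
  rewrite -Rpow_mult_distr. apply: pow_incr.
  split; first by apply: Rmult_le_pos; [lra | apply: norm_ge_0].
  apply: Rle_trans L' _. rewrite -[X in _ <= X]Rmult_1_l.
  apply: Rmult_le_compat_r; [apply: norm_ge_0 | lra].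
Qed.

End Difference.

(** * Uniform boundedness *)

Section UniformBoundedness.
Context {H : HilbertSpace}.

Lemma linear_add (L : H -> H) (x y : H) : is_linear L -> L (x + y)%V = (L x + L y)%V.
Proof. intros HL. exact (linear_plus L HL x y). Qed.

Lemma linear_mul (L : H -> H) (c : C) (x : H) : is_linear L -> L (c *: x)%V = (c *: L x)%V.
Proof. intros HL. exact (linear_scal L HL c x). Qed.

Lemma linear_sub (L : H -> H) (x y : H) : is_linear L -> L (x - y)%V = (L x - L y)%V.
Proof.
  intros HL.
  have -> : (x - y = x + RtoC (-1) *: y)%V by vec_ring.
  rewrite linear_add // linear_mul //. vec_ring.
Qed.

Lemma ex_lim_cauchy (u : nat -> H) (e : nat -> R) :
  is_lim_seq e 0 ->
  (forall k m, (k <= m)%nat -> norm (u m - u k)%V <= e k) ->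
  exists x : H, forall k, norm (x - u k)%V <= e k.
Proof.
  intros He Hu.
  have [x Hx] : exists x : H, filterlim u eventually (locally x).
  { apply: (proj1 (filterlim_locally_cauchy
      (U := CompleteNormedModule.CompleteSpace C_AbsRing H) u)) => eps.
    have He2 : 0 < eps / 2 by have := cond_pos eps; lra.
    have [K HK] : eventually (fun n => Rabs (e n - 0) < eps / 2).
    { move/is_lim_seq_spec: He => He. exact (He (mkposreal _ He2)). }
    exists (fun n => (K <= n)%nat). split; first by exists K.
    move=> m n Hm Hn. apply: norm_compat1.
    have := norm_minus_triangle (u n) (u K) (u m).
    have := Hu K n Hn. have := Hu K m Hm. rewrite (norm_minus_sym (u K) (u m)).
    have := HK K (le_n K). rewrite Rminus_0_r. have := Rle_abs (e K).
    move=> *.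
    change (norm (u n - u m)%V < eps). lra. }
  exists x => k. apply: le_epsilon => eps Heps.
  have [N HN] := proj1 (filterlim_norm_iff _ u x) Hx eps Heps.
  have := HN (Nat.max N k) ltac:(lia). have := Hu k (Nat.max N k) ltac:(lia).
  rewrite norm_minus_sym => A. rewrite norm_minus_sym => B.
  have := norm_minus_triangle x (u (Nat.max N k)) (u k).
  rewrite (norm_minus_sym (u (Nat.max N k)) (u k)). lra.
Qed.

(** The operator norm need not be attained on the unit ball, but three
    quarters of it are. *)
Lemma near_norming_vector (L : H -> H) : is_linear L ->
  exists v : H, norm v <= 1 /\ forall x, norm (L x) <= 4 / 3 * norm (L v) * norm x.
Proof.
  intros HL.
  have [M [HM B]] := linear_norm L HL.
  have L0 : norm (L vzero) = 0.
  { apply: Rle_antisym; last by apply: norm_ge_0.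
    have := B vzero. rewrite norm_zero. lra. }
  have [s [U Ls]] : { s | is_lub (fun r => exists v : H, norm v <= 1 /\ r = norm (L v)) s }.
  { apply: completeness.
    - exists M => r [v [Hv ->]]. have := B v. have := norm_ge_0 v. nra.
    - exists 0, vzero. rewrite norm_zero L0. lra. }
  have Hs : 0 <= s by apply: U; exists vzero; rewrite norm_zero L0; lra.
  have unit : forall x, norm (L x) <= s * norm x.
  { move=> x. case: (Req_dec (norm x) 0) => Hx.
    - have := B x. rewrite Hx. lra.
    - have Px : 0 < norm x by have := norm_ge_0 x; lra.
      have Pi := Rinv_0_lt_compat _ Px.
      have N : norm (RtoC (/ norm x) *: x)%V = 1.
      { rewrite norm_scal_eq Cmod_RtoC; [by field | lra]. }
      have : norm (L (RtoC (/ norm x) *: x)%V) <= s by apply: U; exists (RtoC (/ norm x) *: x)%V; rewrite N; lra.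
      rewrite linear_mul // norm_scal_eq Cmod_RtoC; last lra.
      move=> /(Rmult_le_compat_r (norm x)) => /(_ (Rlt_le _ _ Px)).
      have -> : / norm x * norm (L x) * norm x = norm (L x) by field.
      done. }
  case: (Req_dec s 0) => Hs0.
  - exists vzero. rewrite norm_zero L0. split; first lra. move=> x.
    have := unit x. rewrite Hs0. lra.
  - have [v [Hv Lv]] : exists v : H, norm v <= 1 /\ 3 / 4 * s < norm (L v).
    { apply: NNPP => N. have : s <= 3 / 4 * s; last lra.
      apply: Ls => r [v [Hv ->]]. apply: Rnot_lt_le => K. apply: N. by exists v. }
    exists v. split => // x. have := unit x. have := norm_ge_0 x. nra.
Qed.

(** The gliding hump argument: if the operators were not uniformly bounded, a
    series of nearly norming vectors of the [L n] with coefficients [3 ^ - k]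
    would have an unbounded orbit, provided that the signs are chosen such
    that no hump is cancelled by the earlier terms. *)
Theorem uniform_boundedness (L : nat -> H -> H) :
  (forall n, is_linear (L n)) ->
  (forall x, exists c, forall n, norm (L n x) <= c) ->
  exists c, forall n x, norm (L n x) <= c * norm x.
Proof.
  intros HL Hb. apply: NNPP => Nb.
  have hump : forall kx : nat * H, exists s : nat * H * R,
    let '(k, x) := kx in let '(n, x', a) := s in
    norm (x' - x)%V <= (/ 3) ^ k /\ 4 ^ k < a /\ (/ 3) ^ k * a <= norm (L n x') /\
    forall y, norm (L n y) <= 4 / 3 * a * norm y.
  { move=> [k x].
    have [n [v [Hv [Ha Ln]]]] : exists n v, norm v <= 1 /\ 4 ^ k < norm (L n v) /\
        forall y, norm (L n y) <= 4 / 3 * norm (L n v) * norm y.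
    { apply: NNPP => N. apply: Nb. exists (4 / 3 * 4 ^ k) => n y.
      have [v [Hv Hy]] := near_norming_vector (L n) (HL n).
      have := Hy y. have := norm_ge_0 y.
      case: (Rle_lt_dec (norm (L n v)) (4 ^ k)) => K; first nra.
      case: N. by exists n, v. }
    have P3 : 0 < (/ 3) ^ k by apply: pow_lt; lra.
    set w := (RtoC ((/ 3) ^ k) *: v)%V.
    have Nw : norm w <= (/ 3) ^ k.
    { rewrite norm_scal_eq Cmod_RtoC; last lra. have := norm_ge_0 v. nra. }
    have Lw : norm (L n w) = (/ 3) ^ k * norm (L n v).
    { rewrite linear_mul // norm_scal_eq Cmod_RtoC; lra. }
    (* one of the two signs does not shorten [L n w] *)
    have [G|G] : norm (L n w) <= norm (L n (x + w)%V) \/ norm (L n w) <= norm (L n (x - w)%V).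
    { have E : norm (RtoC 2 *: L n w)%V <= norm (L n (x + w)%V) + norm (L n (x - w)%V).
      { have -> : (RtoC 2 *: L n w = L n (x + w) - L n (x - w))%V.
        { rewrite linear_add // linear_sub //. vec_ring. }
        rewrite -[X in _ <= _ + X]norm_opp. exact: norm_plus_le. }
      rewrite norm_scal_eq Cmod_RtoC in E; last lra.
      case: (Rle_lt_dec (norm (L n w)) (norm (L n (x + w)%V))) => ?; [left | right]; lra. }
    - exists (n, (x + w)%V, norm (L n v)). rewrite -Lw.
      have -> : (x + w - x = w)%V by vec_ring. done.
    - exists (n, (x - w)%V, norm (L n v)). rewrite -Lw norm_minus_sym.
      have -> : (x - (x - w) = w)%V by vec_ring. done. }
  have [s Hs] := functional_choice _ hump.
  pose x := fix x k := match k with O => vzero | S k => snd (fst (s (k, x k))) end.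
  have X : forall k, exists n a, norm (x (S k) - x k)%V <= (/ 3) ^ k /\ 4 ^ k < a /\
    (/ 3) ^ k * a <= norm (L n (x (S k))) /\ forall y, norm (L n y) <= 4 / 3 * a * norm y.
  { move=> k. have := Hs (k, x k). simpl. case: (s (k, x k)) => [[n x'] a] /= E.
    by exists n, a. }
  have tail : forall k m, (k <= m)%nat ->
    norm (x m - x k)%V <= 3 / 2 * ((/ 3) ^ k - (/ 3) ^ m).
  { move=> k m. elim: m => [|m IH] Hm.
    - have -> : k = 0%nat by lia. have -> : (x 0%nat - x 0%nat = vzero)%V by vec_ring.
      rewrite norm_zero. lra.
    - case: (Nat.eq_dec k (S m)) => [->|Hk].
      + have -> : (x (S m) - x (S m) = vzero)%V by vec_ring. rewrite norm_zero. lra.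
      + have := norm_minus_triangle (x (S m)) (x m) (x k).
        have [n [a [D _]]] := X m. have := IH ltac:(lia).
        rewrite -(tech_pow_Rmult (/ 3) m). lra. }
  have [y Hy] : exists y : H, forall k, norm (y - x k)%V <= 3 / 2 * (/ 3) ^ k.
  { apply: ex_lim_cauchy.
    - have -> : Finite 0 = Rbar_mult (3 / 2) 0 by simpl; f_equal; ring.
      apply: is_lim_seq_scal_l. apply: is_lim_seq_geom. rewrite Rabs_pos_eq; lra.
    - move=> k m Hk. have := tail k m Hk. have : 0 < (/ 3) ^ m by apply: pow_lt; lra. lra. }
  have [c Hc] := Hb y.
  have big : forall k, / 3 * (4 / 3) ^ k <= c.
  { move=> k. have [n [a [_ [Ha [G B]]]]] := X k.
    have := Hc n. have := B (x (S k) - y)%V. have := Hy (S k).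
    rewrite norm_minus_sym -tech_pow_Rmult.
    have P3 : 0 < (/ 3) ^ k by apply: pow_lt; lra.
    have P4 : 0 < 4 ^ k by apply: pow_lt; lra.
    have := norm_ge_0 (x (S k) - y)%V.
    have -> : (4 / 3) ^ k = (/ 3) ^ k * 4 ^ k by rewrite -Rpow_mult_distr; f_equal; field.
    have -> : L n (x (S k) - y)%V = (L n (x (S k)) - L n y)%V by apply: linear_sub.
    have T : norm (L n (x (S k))) <= norm (L n (x (S k)) - L n y)%V + norm (L n y).
    { have {1}-> : (L n (x (S k)) = (L n (x (S k)) - L n y) + L n y)%V by vec_ring.
      exact: norm_plus_le. }
    set d := norm (x (S k) - y)%V. move=> D0 D B' C.
    have : 4 / 3 * a * d <= 4 / 3 * a * (3 / 2 * (/ 3 * (/ 3) ^ k)).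
    { apply: Rmult_le_compat_l; lra. }
    have : (/ 3) ^ k * 4 ^ k <= (/ 3) ^ k * a by apply: Rmult_le_compat_l; lra.
    lra. }
  have [N HN] := Pow_x_infinity (4 / 3) ltac:(rewrite Rabs_pos_eq; lra) (3 * c + 1).
  have := HN N (le_n N). have := big N.
  rewrite Rabs_pos_eq; last by apply: pow_le; lra. lra.
Qed.

End UniformBoundedness.

(** * Semigroups and their generators *)

Definition exp_bound {H : HilbertSpace} (T : R -> H -> H) (M w : R) : Prop :=
  forall t x, 0 <= t -> norm (T t x) <= M * exp (w * t) * norm x.

Section Semigroup.
Context {H : HilbertSpace} (T : R -> H -> H) (sg : is_C0_semigroup T).

Lemma semigroup_linear t : 0 <= t -> is_linear (T t).
Proof. exact: (C0_bounded_linear _ sg). Qed.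

Lemma semigroup_cvg_0 (x : H) eps : 0 < eps ->
  exists d, 0 < d /\ forall t, 0 <= t < d -> norm (T t x - x)%V < eps.
Proof.
  move=> He. have [d [Hd K]] := proj1 (lim_at_right_iff _ _) (C0_continuous _ sg x) eps He.
  exists d. split => // t Ht. case: (Req_dec t 0) => [->|Nt].
  - rewrite (C0_zero _ sg). have -> : (x - x = vzero)%V by vec_ring. by rewrite norm_zero.
  - apply: K. lra.
Qed.

(** Otherwise there would be times [t n] tending to 0 along which the norms of
    [T (t n)] are unbounded, although [T (t n) x] converges for every [x]. *)
Lemma semigroup_locally_bounded :
  exists d M, 0 < d /\ 1 <= M /\ forall t x, 0 <= t <= d -> norm (T t x) <= M * norm x.
Proof.
  apply: NNPP => N.
  have B : forall n : nat, exists t, 0 <= t <= / INR (S n) /\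
      exists x, INR (S n) * norm x < norm (T t x).
  { move=> n. apply: NNPP => K. apply: N. exists (/ INR (S n)), (INR (S n)).
    have P : 1 <= INR (S n) by apply: (le_INR 1); lia.
    split; first by apply: Rinv_0_lt_compat; lra.
    split => // t x Ht. apply: Rnot_lt_le => Hx. apply: K. exists t. split => //. by exists x. }
  have [t Ht] := functional_choice _ B.
  have [c Hc] : exists c, forall n x, norm (T (t n) x) <= c * norm x.
  { apply: uniform_boundedness => [n | x].
    - apply: semigroup_linear. exact: (proj1 (proj1 (Ht n))).
    - have [c Hc] : {c | forall n, norm (T (t n) x) <= c}; last by exists c.
      apply: filterlim_bounded. exists x.
      apply: (proj2 (filterlim_norm_iff eventually (fun n => T (t n) x) x)) => eps He.
      have [d [Hd K]] := semigroup_cvg_0 x eps He.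
      have [m [Hm1 Hm2]] := archimed_cor1 d Hd.
      exists m => n Hn. apply: K. have [[A A'] _] := Ht n. split => //.
      apply: Rle_lt_trans A' _. apply: Rle_lt_trans Hm1.
      apply: Rinv_le_contravar; first by apply: lt_0_INR.
      apply: le_INR. lia. }
  have [n Hn] := INR_unbounded c.
  have [_ [x Hx]] := Ht n. have := Hc n x. rewrite S_INR in Hx.
  have := norm_ge_0 x. nra.
Qed.

Lemma semigroup_exp_bound : exists M w, 1 <= M /\ 0 <= w /\ exp_bound T M w.
Proof.
  have [d [M [Hd [HM B]]]] := semigroup_locally_bounded.
  set w := ln M / d.
  have Hw : 0 <= w.
  { apply: Rdiv_le_0_compat => //. rewrite -ln_1. apply: ln_le; lra. }
  have EM : exp (w * d) = M.
  { rewrite /w. have -> : ln M / d * d = ln M by field; lra. apply: exp_ln. lra. }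
  exists M, w. split => //. split => // t x Ht.
  have [k Hk] := INR_unbounded (t / d).
  have {}Hk : t <= INR k * d.
  { have : t / d * d = t by field; lra. nra. }
  elim: k t Ht x Hk => [|k IH] t Ht x Hk.
  - simpl in Hk. have -> : t = 0 by lra. rewrite (C0_zero _ sg) Rmult_0_r exp_0.
    have := norm_ge_0 x. nra.
  - case: (Rle_lt_dec t d) => Htd.
    + apply: Rle_trans (B t x ltac:(lra)) _. apply: Rmult_le_compat_r; first by apply: norm_ge_0.
      have := exp_ineq1_le (w * t). have : 0 <= w * t by nra. nra.
    + rewrite S_INR in Hk.
      have -> : T t x = T d (T (t - d) x).
      { rewrite -(C0_add _ sg); [f_equal; lra | lra | lra]. }
      apply: Rle_trans (B d _ ltac:(lra)) _.
      have := IH (t - d) ltac:(lra) x ltac:(lra).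
      have -> : exp (w * t) = M * exp (w * (t - d)).
      { rewrite -{1}EM -exp_plus. f_equal. ring. }
      move=> I. have := Rmult_le_compat_l M _ _ ltac:(lra) I. nra.
Qed.

Lemma norm_limit_unique (y z : H) :
  (forall eps, 0 < eps -> norm (y - z)%V < eps) -> y = z.
Proof.
  move=> E. have Z : norm (y - z)%V = 0.
  { apply: Rle_antisym; last by apply: norm_ge_0.
    apply: le_epsilon => eps He. have := E eps He. lra. }
  have D : (y - z)%V = vzero := norm_eq_zero _ Z.
  have -> : (y = (y - z) + z)%V by vec_ring. rewrite D. vec_ring.
Qed.

Definition diff_quotient (t : R) (x : H) : H := (RtoC (/ t) *: (T t x - x))%V.

Lemma generator_graph_iff (x y : H) : generator_graph T x y <->
  forall eps, 0 < eps -> exists d, 0 < d /\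
    forall t, 0 < t < d -> norm (diff_quotient t x - y)%V < eps.
Proof. exact: lim_at_right_iff. Qed.

Lemma generator_graph_unique (x y z : H) :
  generator_graph T x y -> generator_graph T x z -> y = z.
Proof.
  move=> /generator_graph_iff Gy /generator_graph_iff Gz.
  apply: norm_limit_unique => eps He.
  have [d1 [Hd1 K1]] := Gy (eps / 2) ltac:(lra).
  have [d2 [Hd2 K2]] := Gz (eps / 2) ltac:(lra).
  set t := Rmin d1 d2 / 2.
  have Hm : 0 < Rmin d1 d2 by apply: Rmin_glb_lt.
  have L1 := Rmin_l d1 d2. have L2 := Rmin_r d1 d2.
  have := K1 t ltac:(rewrite /t; lra). have := K2 t ltac:(rewrite /t; lra).
  have := norm_minus_triangle y (diff_quotient t x) z.
  rewrite (norm_minus_sym y (diff_quotient t x)). lra.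
Qed.

Lemma generator_graph_plus (x x' y y' : H) :
  generator_graph T x y -> generator_graph T x' y' ->
  generator_graph T (x + x')%V (y + y')%V.
Proof.
  move=> /generator_graph_iff Gy /generator_graph_iff Gz.
  apply/generator_graph_iff => eps He.
  have [d1 [Hd1 K1]] := Gy (eps / 2) ltac:(lra).
  have [d2 [Hd2 K2]] := Gz (eps / 2) ltac:(lra).
  exists (Rmin d1 d2). split; first by apply: Rmin_glb_lt.
  have L1 := Rmin_l d1 d2. have L2 := Rmin_r d1 d2.
  move=> t Ht.
  have -> : (diff_quotient t (x + x') - (y + y')
    = (diff_quotient t x - y) + (diff_quotient t x' - y'))%V.
  { rewrite /diff_quotient (linear_add (T t)); last (apply: semigroup_linear; lra). vec_ring. }
  apply: Rle_lt_trans (norm_plus_le _ _) _.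
  have := K1 t ltac:(lra). have := K2 t ltac:(lra). lra.
Qed.

(** Applies to multiples of the identity, which makes the generator homogeneous,
    and to the operators [T t] themselves. *)
Lemma generator_graph_image (L : H -> H) (x y : H) : is_linear L ->
  (forall t z, 0 < t -> T t (L z) = L (T t z)) ->
  generator_graph T x y -> generator_graph T (L x) (L y).
Proof.
  move=> HL C /generator_graph_iff G. apply/generator_graph_iff => eps He.
  have [M [HM B]] := linear_norm L HL.
  have [d [Hd K]] := G (eps / M) ltac:(by apply: Rdiv_lt_0_compat).
  exists d. split => // t Ht.
  have -> : (diff_quotient t (L x) - L y = L (diff_quotient t x - y))%V.
  { rewrite /diff_quotient (linear_sub L) // (linear_mul L) // (linear_sub L) // C //. lra. }
  apply: Rle_lt_trans (B _) _.
  have := K t Ht => E. apply (Rmult_lt_compat_l M) in E => //.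
  have -> : eps = M * (eps / M) by field; lra. exact: E.
Qed.

Section Generator.
Context (dom : H -> Prop) (A : H -> H) (gen : is_generator dom A T).

Lemma generator_intro (x y : H) : generator_graph T x y -> dom x /\ A x = y.
Proof.
  move=> G. have D : dom x by apply/(generator_dom _ _ _ gen); exists y.
  split => //. exact: generator_graph_unique (generator_val _ _ _ gen x D) G.
Qed.

Lemma scal_is_linear (c : C) : is_linear (fun z : H => c *: z)%V.
Proof.
  constructor.
  - move=> x y. change ((c *: (x + y) = c *: x + c *: y)%V). vec_ring.
  - move=> k x. change ((c *: (k *: x) = k *: (c *: x))%V). vec_ring.
  - exists (Cmod c + 1). have := Cmod_ge_0 c. split; first lra.
    move=> x. rewrite norm_scal_eq. have := norm_ge_0 x. nra.
Qed.

Lemma generator_is_linear : is_linear_on dom A.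
Proof.
  have P : forall x y, dom x -> dom y -> dom (x + y)%V /\ A (x + y)%V = (A x + A y)%V.
  { move=> x y Hx Hy. apply: generator_intro.
    apply: generator_graph_plus; exact: (generator_val _ _ _ gen). }
  have S : forall c x, dom x -> dom (c *: x)%V /\ A (c *: x)%V = (c *: A x)%V.
  { move=> c x Hx. apply: generator_intro.
    apply: (generator_graph_image (fun z => c *: z)%V).
    - exact: scal_is_linear.
    - move=> t z Ht. apply: linear_mul. apply: semigroup_linear. lra.
    - exact: (generator_val _ _ _ gen). }
  constructor; move=> *; by [apply P | apply S].
Qed.

Lemma generator_invariant t x : 0 <= t -> dom x ->
  dom (T t x) /\ A (T t x) = T t (A x).
Proof.
  move=> Ht Hx. apply: generator_intro. apply: generator_graph_image.
  - exact: semigroup_linear.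
  - move=> s z Hs. rewrite -!(C0_add _ sg); try lra. f_equal. ring.
  - exact: (generator_val _ _ _ gen).
Qed.

End Generator.
End Semigroup.

(** * Density of the domain *)

(** The integral of an orbit is taken in the real Banach space that underlies
    the complex one, with the same norm and uniform structure. *)
Section RealScalars.
Context (H : HilbertSpace).

Definition real_scal_mixin : ModuleSpace.mixin_of R_Ring
  (CompleteNormedModule.AbelianGroup C_AbsRing H).
Proof.
  refine (ModuleSpace.Mixin R_Ring (CompleteNormedModule.AbelianGroup C_AbsRing H)
    (fun (r : R) (x : H) => (RtoC r *: x)%V) _ _ _ _).
  - move=> r s u. change (RtoC r *: (RtoC s *: u) = RtoC (r * s) *: u)%V.
    rewrite RtoC_mult. vec_ring.
  - move=> u. change (RtoC 1 *: u = u)%V. vec_ring.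
  - move=> r u v. change (RtoC r *: (u + v) = RtoC r *: u + RtoC r *: v)%V. vec_ring.
  - move=> r s u. change (RtoC (r + s) *: u = RtoC r *: u + RtoC s *: u)%V.
    rewrite RtoC_plus. vec_ring.
Defined.

Definition real_module_class : ModuleSpace.class_of R_Ring H :=
  ModuleSpace.Class R_Ring H _ real_scal_mixin.

Definition real_aux : NormedModuleAux R_AbsRing :=
  NormedModuleAux.Pack R_AbsRing H
    (NormedModuleAux.Class R_AbsRing H real_module_class
      (UniformSpace.class (CompleteNormedModule.UniformSpace C_AbsRing H))) H.

Definition real_norm_mixin : NormedModule.mixin_of R_AbsRing real_aux.
Proof.
  refine (NormedModule.Mixin R_AbsRing real_aux
    (fun x : H => norm x) (@norm_factor C_AbsRing H) _ _ _ _ _).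
  - exact: norm_plus_le.
  - move=> r x. apply: Req_le. change (norm (RtoC r *: x)%V = Rabs r * norm x).
    by rewrite norm_scal_eq Cmod_R.
  - exact: norm_compat1.
  - exact: norm_compat2.
  - exact: norm_eq_zero.
Defined.

Definition real_normed_class : NormedModule.class_of R_AbsRing H :=
  NormedModule.Class R_AbsRing H (NormedModuleAux.class R_AbsRing real_aux) real_norm_mixin.

Definition real_space : CompleteNormedModule R_AbsRing :=
  CompleteNormedModule.Pack R_AbsRing H
    (CompleteNormedModule.Class R_AbsRing H real_normed_class
      (CompleteSpace.mixin _ (CompleteSpace.class (CompleteNormedModule.CompleteSpace C_AbsRing H)))) H.
End RealScalars.

Lemma is_RInt_linear {V W : NormedModule R_AbsRing} (L : V -> W) (f : R -> V) a b l :
  is_linear L -> is_RInt f a b l -> is_RInt (fun t => L (f t)) a b (L l).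
Proof.
  move=> HL If. rewrite /is_RInt.
  apply: (filterlim_ext (fun ptd => L (scal (sign (b - a)) (Riemann_sum f ptd)))).
  - move=> ptd. rewrite (linear_scal L HL). f_equal.
    apply: (SF_cons_ind (fun ptd => L (Riemann_sum f ptd) = Riemann_sum (fun t => L (f t)) ptd))
      => [x0|h0 p IH].
    + rewrite /Riemann_sum /=. have -> : (@zero V) = scal 0 (@zero V) by rewrite scal_zero_r.
      rewrite (linear_scal L HL). exact: scal_zero_l.
    + by rewrite !Riemann_sum_cons (linear_plus L HL) (linear_scal L HL) IH.
  - apply: filterlim_comp If _. exact: (linear_cont L l HL).
Qed.

Section Density.
Context {H : HilbertSpace} (T : R -> H -> H) (sg : is_C0_semigroup T).

Lemma semigroup_uniformly_continuous (x : H) (b eps : R) : 0 <= b -> 0 < eps ->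
  exists d, 0 < d /\ forall s t, 0 <= s <= b -> 0 <= t <= b -> Rabs (t - s) < d ->
    norm (T t x - T s x)%V < eps.
Proof.
  move=> Hb He.
  have [M [w [HM [Hw B]]]] := semigroup_exp_bound T sg.
  have PE := exp_pos (w * b).
  have PM : 0 < M * exp (w * b) by apply: Rmult_lt_0_compat; lra.
  have [d [Hd K]] := semigroup_cvg_0 T sg x (eps / (M * exp (w * b)))
    ltac:(by apply: Rdiv_lt_0_compat).
  have ordered : forall s t, 0 <= s <= t -> s <= b -> t - s < d ->
      norm (T t x - T s x)%V < eps.
  { move=> s t Hst Hs Hd'.
    have -> : T t x = T s (T (t - s) x).
    { rewrite -(C0_add _ sg); try lra. f_equal. ring. }
    rewrite -(linear_sub (T s)); last (apply: (semigroup_linear T sg); lra).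
    apply: Rle_lt_trans (B s _ ltac:(lra)) _.
    have E : exp (w * s) <= exp (w * b).
    { case: (Req_dec (w * s) (w * b)) => [->|?]; first lra.
      apply: Rlt_le. apply: exp_increasing. nra. }
    have N := K (t - s) ltac:(lra). have N0 := norm_ge_0 (T (t - s) x - x)%V.
    have -> : eps = M * exp (w * b) * (eps / (M * exp (w * b))) by field; lra.
    apply: Rle_lt_trans (Rmult_le_compat_r _ _ (M * exp (w * b)) N0 _) _.
    { apply: Rmult_le_compat_l; lra. }
    exact: Rmult_lt_compat_l. }
  exists d. split => // s t Hs Ht Hd'.
  have := Rle_abs (t - s). have := Rle_abs (- (t - s)). rewrite Rabs_Ropp => A1 A2.
  case: (Rle_lt_dec s t) => Hst.
  - apply: ordered; lra.
  - rewrite norm_minus_sym. apply: ordered; lra.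
Qed.

(** The orbit is frozen at negative times, which makes it continuous on the
    whole line. *)
Definition orbit (x : H) (t : R) : real_space H := T (Rmax 0 t) x.

Lemma orbit_pos x t : 0 <= t -> orbit x t = T t x.
Proof. move=> Ht. by rewrite /orbit Rmax_right. Qed.

Lemma orbit_continuous x t : continuous (orbit x) t.
Proof.
  apply: (proj2 (filterlim_norm_iff (locally t) (fun s => T (Rmax 0 s) x) _)) => eps He.
  have B0 := Rmax_l 0 t.
  have [d [Hd K]] := semigroup_uniformly_continuous x (Rmax 0 t + 1) eps ltac:(lra) He.
  have Hm : 0 < Rmin d 1 by apply: Rmin_glb_lt; lra.
  exists (mkposreal _ Hm) => s Hs. change (Rabs (s - t) < Rmin d 1) in Hs.
  have L1 := Rmin_l d 1. have L2 := Rmin_r d 1.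
  have := Rle_abs (s - t). have := Rle_abs (- (s - t)). rewrite Rabs_Ropp => A1 A2.
  have C : Rabs (Rmax 0 s - Rmax 0 t) <= Rabs (s - t).
  { apply: Rabs_le. move: A1 A2. rewrite /Rmax.
    case: (Rle_dec 0 s) => ?; case: (Rle_dec 0 t) => ?; lra. }
  have := Rle_abs (Rmax 0 s - Rmax 0 t) => C2.
  have := Rmax_l 0 s => C3.
  apply: K; lra.
Qed.

Definition orbit_integral (x : H) (u : R) : H := RInt (orbit x) 0 u.

Lemma is_RInt_orbit x a b : is_RInt (orbit x) a b (orbit_integral x b - orbit_integral x a)%V.
Proof.
  have E : forall a b, ex_RInt (orbit x) a b.
  { move=> ? ?. apply: ex_RInt_continuous => *. exact: orbit_continuous. }
  have -> : (orbit_integral x b - orbit_integral x a)%V = RInt (orbit x) a b.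
  { rewrite /orbit_integral.
    have <- := RInt_Chasles (orbit x) 0 a b (E _ _) (E _ _).
    set p : H := RInt (orbit x) 0 a. set q : H := RInt (orbit x) a b.
    change (((p + q) - p = q)%V). vec_ring. }
  exact: RInt_correct.
Qed.

Lemma orbit_integral_0 x : orbit_integral x 0 = vzero.
Proof. exact: (RInt_point 0 (orbit x)). Qed.

Lemma semigroup_orbit_integral x s b : 0 <= s -> 0 <= b ->
  T s (orbit_integral x b) = (orbit_integral x (b + s) - orbit_integral x s)%V.
Proof.
  move=> Hs Hb.
  have L := semigroup_linear T sg s Hs.
  have LR : is_linear (T s : real_space H -> real_space H).
  { constructor.
    - exact: (linear_plus _ L).
    - move=> r x'. exact: (linear_scal _ L (RtoC r) x').
    - exact: (linear_norm _ L). }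
  have I1 := is_RInt_linear _ _ _ _ _ LR (is_RInt_orbit x 0 b).
  have I2 : is_RInt (fun t => scal 1 (orbit x (1 * t + s))) 0 b
     (orbit_integral x (b + s) - orbit_integral x s)%V.
  { apply: is_RInt_comp_lin. rewrite Rmult_0_r Rmult_1_l Rplus_0_l. exact: is_RInt_orbit. }
  have I3 : is_RInt (fun t => T s (orbit x t) : real_space H) 0 b
     (orbit_integral x (b + s) - orbit_integral x s)%V.
  { apply: is_RInt_ext I2 => t. rewrite Rmin_left // => Ht.
    rewrite scal_one Rmult_1_l !orbit_pos; try lra.
    rewrite -(C0_add _ sg) //; [by rewrite Rplus_comm | lra]. }
  have := is_RInt_unique _ _ _ _ I3. rewrite (is_RInt_unique _ _ _ _ I1) => E.
  rewrite -E orbit_integral_0. f_equal. vec_ring.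
Qed.

(** The fundamental theorem of calculus in terms of difference quotients. *)
Lemma orbit_integral_right_derivative x a eps : 0 <= a -> 0 < eps ->
  exists d, 0 < d /\ forall s, 0 < s < d ->
    norm (RtoC (/ s) *: (orbit_integral x (a + s) - orbit_integral x a) - T a x)%V < eps.
Proof.
  move=> Ha He.
  have D : is_derive (orbit_integral x : R -> real_space H) a (orbit x a).
  { apply: (is_derive_RInt _ _ 0); last by apply: orbit_continuous.
    apply: filter_forall => u. have := is_RInt_orbit x 0 u.
    rewrite orbit_integral_0. by have -> : (orbit_integral x u - vzero = orbit_integral x u)%V by vec_ring. }
  have He2 : 0 < eps / 2 by lra.
  have [d Hd] := proj2 D a (fun P HP => HP) (mkposreal _ He2).
  exists d. split; first by apply: cond_pos. move=> s Hs.
  have B : ball (a : R_UniformSpace) d (a + s).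
  { change (Rabs (a + s - a) < d). rewrite Rabs_pos_eq; lra. }
  have := Hd (a + s) B.
  change (norm ((orbit_integral x (a + s) - orbit_integral x a)
    - RtoC (a + s - a) *: T (Rmax 0 a) x)%V <= eps / 2 * Rabs (a + s - a) ->
    norm (RtoC (/ s) *: (orbit_integral x (a + s) - orbit_integral x a) - T a x)%V < eps).
  have -> : a + s - a = s by ring.
  rewrite Rmax_right // Rabs_pos_eq; last lra.
  set v := (orbit_integral x (a + s) - orbit_integral x a)%V.
  have -> : (RtoC (/ s) *: v - T a x = RtoC (/ s) *: (v - RtoC s *: T a x))%V.
  { rewrite RtoC_inv; last lra. vec_field. move=> [E]. lra. }
  have Hi : 0 < / s by apply: Rinv_0_lt_compat; lra.
  rewrite norm_scal_eq Cmod_RtoC; last lra.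
  move=> /(Rmult_le_compat_l (/ s) _ _ (Rlt_le _ _ Hi)).
  have -> : / s * (eps / 2 * s) = eps / 2 by field; lra.
  lra.
Qed.

(** Averages of an orbit over short intervals converge to its starting point;
    they lie in the domain, since applying [T t] to such an integral only shifts
    the interval, so that the difference quotient converges to the difference of
    the orbit at the two end points. *)
Lemma dom_dense (dom : H -> Prop) (A : H -> H) (gen : is_generator dom A T)
    (x : H) (eps : R) :
  0 < eps -> exists y, dom y /\ norm (y - x)%V < eps.
Proof.
  move=> He.
  have D : forall b, 0 < b -> dom (orbit_integral x b).
  { move=> b Hb. apply/(generator_dom _ _ _ gen). exists (T b x - x)%V.
    apply/generator_graph_iff => e Hee.
    have [d1 [Hd1 K1]] := orbit_integral_right_derivative x b (e / 2) ltac:(lra) ltac:(lra).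
    have [d2 [Hd2 K2]] := orbit_integral_right_derivative x 0 (e / 2) ltac:(lra) ltac:(lra).
    exists (Rmin d1 d2). split; first by apply: Rmin_glb_lt.
    have L1 := Rmin_l d1 d2. have L2 := Rmin_r d1 d2. move=> t Ht.
    have := K1 t ltac:(lra). have := K2 t ltac:(lra).
    rewrite Rplus_0_l orbit_integral_0 (C0_zero _ sg) /diff_quotient.
    rewrite semigroup_orbit_integral; [|lra|lra].
    set u := (RtoC (/ t) *: (orbit_integral x t - vzero) - x)%V.
    set v := (RtoC (/ t) *: (orbit_integral x (b + t) - orbit_integral x b) - T b x)%V.
    have -> : (RtoC (/ t) *: (orbit_integral x (b + t) - orbit_integral x t
       - orbit_integral x b) - (T b x - x) = v + (- u))%V by rewrite /u /v; vec_ring.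
    have := norm_plus_le v (- u)%V. rewrite [norm (- u)%V]norm_opp. lra. }
  have [d [Hd K]] := orbit_integral_right_derivative x 0 eps ltac:(lra) He.
  exists (RtoC (/ (d / 2)) *: orbit_integral x (d / 2))%V. split.
  - apply: (dom_scal _ _ (generator_is_linear T sg dom A gen)). apply: D. lra.
  - have := K (d / 2) ltac:(lra). rewrite Rplus_0_l orbit_integral_0 (C0_zero _ sg).
    by have -> : (orbit_integral x (d / 2) - vzero = orbit_integral x (d / 2))%V by vec_ring.
Qed.

End Density.

(** * Exponential weights *)

Lemma exp_pow_nat (a : R) k : exp a ^ k = exp (INR k * a).
Proof.
  elim: k => [|k IH]; first by rewrite /= Rmult_0_l exp_0.
  rewrite S_INR -tech_pow_Rmult IH -exp_plus. f_equal. ring.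
Qed.

Lemma exp_le_compat a b : a <= b -> exp a <= exp b.
Proof. move=> [?|->]; [apply: Rlt_le; exact: exp_increasing | exact: Rle_refl]. Qed.

Lemma rsum_interval (lo n : nat) (v : R) K :
  sum_n (fun k => if andb (Nat.leb lo k) (Nat.ltb k (lo + n)) then v else 0) K
  = INR (Nat.min n (S K - lo)) * v.
Proof.
  elim: K => [|K IH].
  - rewrite sum_O. case: (Nat.leb_spec lo 0) => ?; case: (Nat.ltb_spec 0 (lo + n)) => ? /=.
    + have -> : Nat.min n (1 - lo) = 1%nat by lia. simpl. real_ring.
    + have -> : Nat.min n (1 - lo) = 0%nat by lia. simpl. real_ring.
    + have -> : Nat.min n (1 - lo) = 0%nat by lia. simpl. real_ring.
    + have -> : Nat.min n (1 - lo) = 0%nat by lia. simpl. real_ring.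
  - rewrite rsum_Sn IH.
    case: (Nat.leb_spec lo (S K)) => ?; case: (Nat.ltb_spec (S K) (lo + n)) => ?;
      cbv beta iota delta [andb].
    + have -> : Nat.min n (S (S K) - lo) = S (Nat.min n (S K - lo)) by lia.
      rewrite S_INR. real_ring.
    + have -> : Nat.min n (S (S K) - lo) = Nat.min n (S K - lo) by lia. real_ring.
    + have -> : Nat.min n (S (S K) - lo) = Nat.min n (S K - lo) by lia. real_ring.
    + have -> : Nat.min n (S (S K) - lo) = Nat.min n (S K - lo) by lia. real_ring.
Qed.

Lemma rsum_geometric_le (q : R) K : 0 < q < 1 -> sum_n (fun k => q ^ k) K <= / (1 - q).
Proof.
  move=> Hq. have E : (1 - q) * sum_n (fun k => q ^ k) K = 1 - q ^ S K.
  { elim: K => [|K IH]; first by rewrite sum_O /=; real_ring.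
    rewrite rsum_Sn Rmult_plus_distr_l IH -!tech_pow_Rmult. real_ring. }
  apply: (Rmult_le_reg_l (1 - q)); first lra. rewrite E Rinv_r; last lra.
  have : 0 < q ^ S K by apply: pow_lt; lra. lra.
Qed.

(** The multiplier [phi] of the energy estimate in steps of length [1 / n]. It
    vanishes at time 0, where the weighted orbit has to start, and satisfies
    [phi'^2 <= c^2 phi^2] after the first unit of time. It grows like [exp (c t)]
    up to step [J], which is where the decay comes from, and is constant
    afterwards, so that it does not spoil the summability of the orbit. *)
Definition weight (c : R) (n J k : nat) : R :=
  if Nat.leb k n then INR k / INR n
  else (1 + c / INR n) ^ (Nat.min k J - n).

Section Weight.
Context (c : R) (n J : nat) (Hc : 0 < c) (Hn : (0 < n)%nat) (HJ : (n <= J)%nat).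

Lemma weight_0 : weight c n J 0 = 0.
Proof. rewrite /weight /=. exact: Rmult_0_l. Qed.

Lemma weight_pow k : (n <= k)%nat -> weight c n J k = (1 + c / INR n) ^ (Nat.min k J - n).
Proof.
  move=> Hk. rewrite /weight. case: Nat.leb_spec => // Hk'.
  have -> : k = n by lia. have -> : (Nat.min n J - n = 0)%nat by lia.
  rewrite pow_O. apply: Rinv_r. apply: not_0_INR. lia.
Qed.

Lemma weight_ratio_gt : 0 < c / INR n.
Proof. apply: Rdiv_lt_0_compat => //. exact: lt_0_INR. Qed.

Lemma weight_nonneg k : 0 <= weight c n J k.
Proof.
  have P := weight_ratio_gt. have Pn := lt_0_INR n Hn.
  rewrite /weight. case: Nat.leb_spec => _.
  - apply: Rdiv_le_0_compat => //. exact: pos_INR.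
  - apply: pow_le. lra.
Qed.

Lemma weight_le k : weight c n J k <= exp (c * (INR (J - n) / INR n)).
Proof.
  have P := weight_ratio_gt. have Pn := lt_0_INR n Hn.
  have PJ := pos_INR (J - n).
  case: (Nat.le_gt_cases n k) => Hk.
  - rewrite weight_pow //.
    have -> : c * (INR (J - n) / INR n) = INR (J - n) * (c / INR n) by field; lra.
    rewrite -exp_pow_nat.
    apply: Rle_trans (Rle_pow (1 + c / INR n) _ (J - n) _ _) _; [lra | lia |].
    apply: pow_incr. have := exp_ineq1_le (c / INR n). lra.
  - have -> : weight c n J k = INR k / INR n.
    { rewrite /weight. case: Nat.leb_spec => //. lia. }
    apply: (Rle_trans _ 1).
    + apply: (Rmult_le_reg_r (INR n)) => //. have -> : INR k / INR n * INR n = INR k by field; lra.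
      rewrite Rmult_1_l. apply: le_INR. lia.
    + rewrite -exp_0. apply: exp_le_compat. apply: Rmult_le_pos; first lra.
      exact: Rdiv_le_0_compat.
Qed.

(** By Bernoulli's inequality one unit of time gains at least [1 + c], whatever
    the step length. *)
Lemma weight_ge p k : (n + n * p <= k <= J)%nat -> (1 + c) ^ p <= weight c n J k.
Proof.
  move=> Hk. have P := weight_ratio_gt. have Pn := lt_0_INR n Hn.
  rewrite weight_pow; last lia.
  apply: (Rle_trans _ ((1 + c / INR n) ^ (n * p))); last first.
  { apply: Rle_pow; [lra | lia]. }
  rewrite pow_mult. apply: pow_incr. split; first lra.
  have := poly n (c / INR n) P. have -> : INR n * (c / INR n) = c by field; lra. lra.
Qed.

Lemma weight_diff k :
  (INR n * (weight c n J (S k) - weight c n J k)) ^ 2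
  <= (if Nat.ltb k n then 1 else 0) + c ^ 2 * weight c n J k ^ 2.
Proof.
  have P := weight_ratio_gt. have Pn := lt_0_INR n Hn.
  case: Nat.ltb_spec => Hk.
  - have -> : INR n * (weight c n J (S k) - weight c n J k) = 1.
    { rewrite /weight. case: Nat.leb_spec => A; last lia. case: Nat.leb_spec => A'; last lia.
      rewrite S_INR. field. lra. }
    have := pow2_ge_0 (weight c n J k). have := pow2_ge_0 c. nra.
  - rewrite !weight_pow; try lia.
    case: (Nat.le_gt_cases J k) => HJk.
    + have -> : Nat.min (S k) J = Nat.min k J by lia.
      have := pow2_ge_0 ((1 + c / INR n) ^ (Nat.min k J - n)). have := pow2_ge_0 c.
      rewrite Rminus_diag Rmult_0_r. nra.
    + have -> : (Nat.min (S k) J - n = S (Nat.min k J - n))%nat by lia.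
      rewrite -tech_pow_Rmult.
      set a := (1 + c / INR n) ^ (Nat.min k J - n).
      have -> : INR n * ((1 + c / INR n) * a - a) = c * a by field; lra.
      rewrite Rpow_mult_distr. lra.
Qed.
End Weight.

(** * The weighted energy estimate *)

Section Energy.
Context {H : HilbertSpace} (T : R -> H -> H) (sg : is_C0_semigroup T)
  (dom : H -> Prop) (A : H -> H) (gen : is_generator dom A T)
  (eta : R) (Heta : 0 < eta) (bound : half_plane_bound dom A eta)
  (M w alpha : R) (HM : 1 <= M) (Hw : 0 <= w) (Halpha : w < alpha)
  (growth : exp_bound T M w).

(** How far a step of the semigroup is from an implicit Euler step. *)
Definition consistency_error (n : nat) (x : H) : H :=
  (diff_quotient T (/ INR n) x - T (/ INR n) (A x))%V.

Lemma consistency_error_cvg x eps : dom x -> 0 < eps ->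
  exists n0, forall n, (n0 <= n)%nat -> norm (consistency_error n x) < eps.
Proof.
  move=> Hx He.
  have [d1 [Hd1 K1]] := proj1 (generator_graph_iff T x (A x))
    (generator_val _ _ _ gen x Hx) (eps / 2) ltac:(lra).
  have [d2 [Hd2 K2]] := semigroup_cvg_0 T sg (A x) (eps / 2) ltac:(lra).
  have [n0 [N1 N2]] := archimed_cor1 (Rmin d1 d2) ltac:(by apply: Rmin_glb_lt).
  exists n0 => n Hn.
  have L1 := Rmin_l d1 d2. have L2 := Rmin_r d1 d2.
  have P0 : 0 < INR n0 by apply: lt_0_INR.
  have Pn : INR n0 <= INR n by apply: le_INR.
  have I1 : 0 < / INR n by apply: Rinv_0_lt_compat; lra.
  have I2 : / INR n <= / INR n0 by apply: Rinv_le_contravar.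
  have := norm_minus_triangle (diff_quotient T (/ INR n) x) (A x) (T (/ INR n) (A x)).
  rewrite (norm_minus_sym (A x)).
  have := K1 (/ INR n) ltac:(lra). have := K2 (/ INR n) ltac:(lra).
  rewrite /consistency_error. lra.
Qed.

Lemma damped_decay n k (y : H) : (0 < n)%nat ->
  (exp (- (alpha / INR n)) ^ k) ^ 2 * norm (T (INR k / INR n) y) ^ 2
  <= M ^ 2 * norm y ^ 2 * exp (- (2 * (alpha - w) / INR n)) ^ k.
Proof.
  move=> Hn. have Pn := lt_0_INR n Hn. have Pk := pos_INR k.
  have -> : exp (- (2 * (alpha - w) / INR n)) ^ k
    = ((exp (- (alpha / INR n)) ^ k) * exp (w * (INR k / INR n))) ^ 2.
  { rewrite !exp_pow_nat -exp_plus exp_pow_nat. f_equal. simpl INR. field. lra. }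
  have G := growth (INR k / INR n) y ltac:(by apply: Rdiv_le_0_compat).
  rewrite -!Rpow_mult_distr. apply: pow_incr.
  have P : 0 <= exp (- (alpha / INR n)) ^ k by apply: pow_le; apply: Rlt_le; apply: exp_pos.
  split; first by apply: Rmult_le_pos => //; apply: norm_ge_0.
  apply: Rle_trans (Rmult_le_compat_l _ _ _ P G) _. apply: Req_le. ring.
Qed.

Lemma norm_sqr_plus_le (u v : H) : norm (u + v)%V ^ 2 <= 2 * norm u ^ 2 + 2 * norm v ^ 2.
Proof.
  have := norm_plus_le u v. have := norm_ge_0 (u + v)%V.
  have := pow2_ge_0 (norm u - norm v). nra.
Qed.

(** The energy bound asks for compact support; a sharp cut-off after step [K + 1]
    is enough, because it takes place where the damped orbit is small. *)
Definition weighted_orbit (n J K : nat) (x : H) (k : nat) : H :=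
  if Nat.leb k (S K) then (RtoC (weight (eta / 2) n J k) *: T (INR k / INR n) x)%V
  else vzero.

Lemma weighted_orbit_le n J K x k : (k <= S K)%nat ->
  weighted_orbit n J K x k = (RtoC (weight (eta / 2) n J k) *: T (INR k / INR n) x)%V.
Proof. move=> Hk. rewrite /weighted_orbit. case: Nat.leb_spec => //. lia. Qed.

(** A discrete product rule: the orbit almost solves [u' = A u], so that only
    the difference quotient of the weight remains. *)
Lemma euler_residue_weighted n J K x k : (0 < n)%nat -> dom x -> (k <= K)%nat ->
  euler_residue A (/ INR n) (weighted_orbit n J K x) k
  = (RtoC (INR n * (weight (eta / 2) n J (S k) - weight (eta / 2) n J k)) *: T (INR k / INR n) x
     + RtoC (weight (eta / 2) n J (S k)) *: T (INR k / INR n) (consistency_error n x))%V.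
Proof.
  move=> Hn Hx Hk. have Pn := lt_0_INR n Hn. have Pk := pos_INR k.
  have Pi : 0 < / INR n by apply: Rinv_0_lt_compat.
  have Pt : 0 <= INR k / INR n by apply: Rdiv_le_0_compat.
  have L := semigroup_linear T sg _ Pt.
  rewrite /euler_residue !weighted_orbit_le; try lia.
  have split_step : forall y, T (INR (S k) / INR n) y = T (INR k / INR n) (T (/ INR n) y).
  { move=> y. rewrite -(C0_add _ sg) //; last lra. f_equal. rewrite S_INR. field. lra. }
  have [D C] := generator_invariant T sg dom A gen (INR (S k) / INR n) x
    ltac:(apply: Rdiv_le_0_compat => //; apply: pos_INR) Hx.
  rewrite (op_scal _ _ (generator_is_linear T sg dom A gen)) // C !split_step.
  rewrite /consistency_error /diff_quotient (linear_sub _ _ _ L) (linear_mul _ _ _ L)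
    (linear_sub _ _ _ L) Rinv_inv RtoC_mult RtoC_minus.
  vec_ring.
Qed.

(** The jump at the cut-off is of order [n], but it is multiplied with the tail
    of a damped orbit. *)
Lemma euler_residue_last n J K x : (0 < n)%nat -> dom x ->
  euler_residue A (/ INR n) (weighted_orbit n J K x) (S K)
  = (RtoC (- (INR n * weight (eta / 2) n J (S K))) *: T (INR (S K) / INR n) x)%V.
Proof.
  move=> Hn Hx. have Pn := lt_0_INR n Hn.
  rewrite /euler_residue (weighted_orbit_le n J K x (S K)) //.
  have -> : weighted_orbit n J K x (S (S K)) = vzero.
  { rewrite /weighted_orbit. case: Nat.leb_spec => //. lia. }
  have -> : A vzero = vzero.
  { have -> : vzero = (RtoC 0 *: x)%V by vec_ring.
    rewrite (op_scal _ _ (generator_is_linear T sg dom A gen)) //. vec_ring. }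
  rewrite Rinv_inv RtoC_opp RtoC_mult. vec_ring.
Qed.

(** In the energy bound for the weighted orbit, damped by [exp (- alpha t)], the
    part [2 (eta / 2)^2 phi^2] of the squared residue is half of the left-hand
    side and is absorbed there. What remains are the first unit of time, the
    consistency error and the cut-off. *)
Lemma weighted_energy_bound n J K x : (0 < n)%nat -> (n <= J)%nat -> dom x ->
  let Phi := exp (eta / 2 * (INR (J - n) / INR n)) in
  let q := exp (- (2 * (alpha - w) / INR n)) in
  eta ^ 2 / 2 * sum_n (fun k => weight (eta / 2) n J k ^ 2 *
     ((exp (- (alpha / INR n)) ^ k) ^ 2 * norm (T (INR k / INR n) x) ^ 2)) K
  <= 2 * INR n * M ^ 2 * norm x ^ 2
     + 2 * Phi ^ 2 * M ^ 2 * norm (consistency_error n x) ^ 2 / (1 - q)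
     + INR n ^ 2 * Phi ^ 2 * M ^ 2 * norm x ^ 2 * q ^ (S K).
Proof.
  move=> Hn HJ Hx Phi q. have Pn := lt_0_INR n Hn.
  set r := exp (- (alpha / INR n)).
  set W := weight (eta / 2) n J.
  set E := consistency_error n x.
  set b := fun k => (r ^ k) ^ 2 * norm (T (INR k / INR n) x) ^ 2.
  have Hc : 0 < eta / 2 by lra.
  have HW k : 0 <= W k <= Phi.
  { split; [exact: weight_nonneg | exact: weight_le]. }
  have Hq : 0 < q < 1.
  { split; first by apply: exp_pos. rewrite -exp_0. apply: exp_increasing.
    have : 0 < 2 * (alpha - w) / INR n by apply: Rdiv_lt_0_compat; lra. lra. }
  have Hr : 0 < r <= 1.
  { split; first by apply: exp_pos. rewrite -exp_0. apply: exp_le_compat.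
    have : 0 < alpha / INR n by apply: Rdiv_lt_0_compat; lra. lra. }
  have Hb k : 0 <= b k <= M ^ 2 * norm x ^ 2.
  { split; first by apply: Rmult_le_pos; apply: pow2_ge_0.
    apply: Rle_trans (damped_decay n k x Hn) _. rewrite -/q.
    rewrite -[X in _ <= X]Rmult_1_r. apply: Rmult_le_compat_l.
    - apply: Rmult_le_pos; apply: pow2_ge_0.
    - rewrite -(pow1 k). apply: pow_incr. lra. }
  have lin := generator_is_linear T sg dom A gen.
  have D := discrete_energy_bound dom A lin eta (/ INR n) r (weighted_orbit n J K x) (S K)
    bound Heta (Rinv_0_lt_compat _ Pn) Hr.
  have F k : dom (weighted_orbit n J K x k).
  { have D0 : dom vzero.
    { have -> : vzero = (RtoC 0 *: x)%V by vec_ring. exact: (dom_scal _ _ lin). }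
    rewrite /weighted_orbit. case: Nat.leb_spec => // _. apply: (dom_scal _ _ lin).
    apply: (proj1 (generator_invariant T sg dom A gen _ x _ Hx)).
    by apply: Rdiv_le_0_compat => //; apply: pos_INR. }
  have F0 : weighted_orbit n J K x 0 = vzero.
  { rewrite weighted_orbit_le; last lia. rewrite weight_0. vec_ring. }
  have FS : weighted_orbit n J K x (S (S K)) = vzero.
  { rewrite /weighted_orbit. case: Nat.leb_spec => //. lia. }
  have {D F F0 FS} := D F F0 FS.
  rewrite !rsum_Sn.
  have -> : sum_n (fun k => (r ^ k) ^ 2 * norm (weighted_orbit n J K x k) ^ 2) K
    = sum_n (fun k => W k ^ 2 * b k) K.
  { apply: sum_n_ext_loc => k Hk. rewrite weighted_orbit_le; last lia.
    rewrite norm_scal_eq Cmod_RtoC; last exact: (proj1 (HW k)). rewrite /b -/(W k). real_ring. }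
  have last : (r ^ S K) ^ 2 * norm (euler_residue A (/ INR n) (weighted_orbit n J K x) (S K)) ^ 2
    <= INR n ^ 2 * Phi ^ 2 * M ^ 2 * norm x ^ 2 * q ^ S K.
  { rewrite euler_residue_last // norm_scal_eq Cmod_R Rabs_Ropp Rabs_pos_eq; last first.
    { apply: Rmult_le_pos; [lra | exact: (proj1 (HW _))]. }
    have B := damped_decay n (S K) x Hn. rewrite -/q -/r in B. rewrite -/(W _).
    have V : W (S K) ^ 2 <= Phi ^ 2 by apply: pow_incr; exact: HW.
    have P : 0 <= INR n ^ 2 * W (S K) ^ 2 by apply: Rmult_le_pos; apply: pow2_ge_0.
    have B' := Rmult_le_compat_l _ _ _ P B.
    have P2 : 0 <= INR n ^ 2 * (M ^ 2 * norm x ^ 2 * q ^ S K).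
    { apply: Rmult_le_pos; first exact: pow2_ge_0.
      apply: Rmult_le_pos; last by apply: pow_le; lra.
      apply: Rmult_le_pos; exact: pow2_ge_0. }
    have V' := Rmult_le_compat_l _ _ _ P2 V.
    rewrite (Rpow_mult_distr (INR n * W (S K))) (Rpow_mult_distr (INR n)). lra. }
  have head : sum_n (fun k => (r ^ k) ^ 2 * norm (euler_residue A (/ INR n) (weighted_orbit n J K x) k) ^ 2) K
    <= sum_n (fun k => 2 * (M ^ 2 * norm x ^ 2) * (if andb (Nat.leb 0 k) (Nat.ltb k (0 + n)) then 1 else 0)
         + (eta ^ 2 / 2 * (W k ^ 2 * b k)
         + 2 * Phi ^ 2 * M ^ 2 * norm E ^ 2 * q ^ k)) K.
  { apply: rsum_le => k Hk. rewrite euler_residue_weighted // -/E -!/(W _).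
    set d := INR n * (W (S k) - W k).
    have Pr : 0 <= (r ^ k) ^ 2 by apply: pow2_ge_0.
    have S1 := norm_sqr_plus_le (RtoC d *: T (INR k / INR n) x)%V
      (RtoC (W (S k)) *: T (INR k / INR n) E)%V.
    rewrite !norm_scal_eq !Cmod_R (Rpow_mult_distr (Rabs d)) (Rpow_mult_distr (Rabs (W (S k)))) !pow2_abs in S1.
    apply: Rle_trans (Rmult_le_compat_l _ _ _ Pr S1) _.
    have Dk := weight_diff (eta / 2) n J Hc Hn HJ k. rewrite -!/(W _) -/d in Dk.
    have DE := damped_decay n k E Hn. rewrite -/r -/q in DE.
    have V : W (S k) ^ 2 <= Phi ^ 2 by apply: pow_incr; exact: HW.
    have [B0 B1] := Hb k.
    have T1 : d ^ 2 * b k <= (if Nat.ltb k n then 1 else 0) * (M ^ 2 * norm x ^ 2)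
       + eta ^ 2 / 4 * (W k ^ 2 * b k).
    { apply: Rle_trans (Rmult_le_compat_r _ _ _ B0 Dk) _. case: Nat.ltb; lra. }
    have T2 : W (S k) ^ 2 * ((r ^ k) ^ 2 * norm (T (INR k / INR n) E) ^ 2)
      <= Phi ^ 2 * (M ^ 2 * norm E ^ 2 * q ^ k).
    { apply: Rmult_le_compat => //; first exact: pow2_ge_0.
      apply: Rmult_le_pos; exact: pow2_ge_0. }
    rewrite [Nat.leb 0 k]/= [(0 + n)%nat]/= [andb _ _]/=. rewrite /b in T1 *. lra. }
  rewrite !rsum_plus !rsum_mult rsum_interval in head.
  have G := rsum_geometric_le q K Hq.
  have N : INR (Nat.min n (S K - 0)) <= INR n by apply: le_INR; lia.
  have PX : 0 <= M ^ 2 * norm x ^ 2 by apply: Rmult_le_pos; exact: pow2_ge_0.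
  have PE : 0 <= 2 * Phi ^ 2 * M ^ 2 * norm E ^ 2.
  { do 3 (apply: Rmult_le_pos; last exact: pow2_ge_0). lra. }
  have GE := Rmult_le_compat_l _ _ _ PE G.
  have NX := Rmult_le_compat_l _ _ _ PX N.
  have R0 : 0 <= eta ^ 2 * ((r ^ S K) ^ 2 * norm (weighted_orbit n J K x (S K)) ^ 2).
  { do 2 (apply: Rmult_le_pos; first exact: pow2_ge_0). exact: pow2_ge_0. }
  rewrite Rmult_plus_distr_l => D.
  change (eta ^ 2 / 2 * sum_n (fun k => W k ^ 2 * b k) K <= 2 * INR n * M ^ 2 * norm x ^ 2
     + 2 * Phi ^ 2 * M ^ 2 * norm E ^ 2 / (1 - q)
     + INR n ^ 2 * Phi ^ 2 * M ^ 2 * norm x ^ 2 * q ^ (S K)).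
  change (sum_n (fun k => q ^ k) K) with (sum_n (pow q) K) in GE. lra.
Qed.

(** In the energy bound only the last unit of time before step [J = (p + 2) n]
    is kept on the left, where the norm of the orbit controls its norm at time
    [p + 2]. As [n] grows both error terms disappear. *)
Lemma damped_bound_on_domain (p : nat) x : dom x ->
  eta ^ 2 / 2 * (1 + eta / 2) ^ (2 * p) * norm (T (INR (p + 2)) x) ^ 2
  <= 2 * M ^ 2 * (M * exp w) ^ 2 * exp (2 * alpha * INR (p + 2)) * norm x ^ 2.
Proof.
  move=> Hx.
  set beta := alpha - w. have Hbeta : 0 < beta by rewrite /beta; lra.
  set Phi := exp (eta / 2 * INR (p + 1)).
  set S0 := (M * exp w) ^ 2 * exp (2 * alpha * INR (p + 2)).
  have PS0 : 0 < S0.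
  { apply: Rmult_lt_0_compat; last by apply: exp_pos. apply: pow_lt.
    apply: Rmult_lt_0_compat; [lra | exact: exp_pos]. }
  have fixed n : (p + 2 <= n)%nat ->
    eta ^ 2 / 2 * (1 + eta / 2) ^ (2 * p) * norm (T (INR (p + 2)) x) ^ 2
    <= S0 * (2 * M ^ 2 * norm x ^ 2
       + 2 * Phi ^ 2 * M ^ 2 * (1 + / (2 * beta)) * norm (consistency_error n x) ^ 2
       + Phi ^ 2 * M ^ 2 * norm x ^ 2 * / beta ^ 2 * / INR n).
  { move=> Hn. have Pn : 0 < INR n by apply: lt_0_INR; lia.
    have Hn1 : 1 <= INR n by apply: (le_INR 1); lia.
    (* the cut-off at time [n] makes the tail [exp (- 2 (alpha - w) n)] *)
    set J := ((p + 2) * n)%nat. set K := (n * n)%nat. set c := eta / 2.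
    set q := exp (- (2 * (alpha - w) / INR n)).
    have HJK : (J <= K)%nat by apply: Nat.mul_le_mono_r.
    have EJ : (J = n + n * p + n)%nat by rewrite /J; lia.
    have HJ : (n <= J)%nat by lia.
    have B := weighted_energy_bound n J K x ltac:(lia) HJ Hx.
    have EP : INR (J - n) / INR n = INR (p + 1).
    { have -> : (J - n = (p + 1) * n)%nat by rewrite /J; lia. rewrite mult_INR. field. lra. }
    cbv zeta in B. rewrite EP -/Phi -/q -/c in B.
    set v := (1 + c) ^ (2 * p) * norm (T (INR (p + 2)) x) ^ 2 / S0.
    have Hv : 0 <= v.
    { apply: Rdiv_le_0_compat => //. apply: Rmult_le_pos; last exact: pow2_ge_0.
      apply: pow_le. rewrite /c. lra. }
    have low : INR n * v <= sum_n (fun k => weight c n J k ^ 2 *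
      ((exp (- (alpha / INR n)) ^ k) ^ 2 * norm (T (INR k / INR n) x) ^ 2)) K.
    { have -> : INR n * v = sum_n (fun k => if andb (Nat.leb (n + n * p) k)
          (Nat.ltb k (n + n * p + n)) then v else 0) K.
      { rewrite rsum_interval. do 2 f_equal. lia. }
      apply: rsum_le => k Hk.
      have Nb : 0 <= (exp (- (alpha / INR n)) ^ k) ^ 2 * norm (T (INR k / INR n) x) ^ 2.
      { apply: Rmult_le_pos; exact: pow2_ge_0. }
      case: (Nat.leb_spec (n + n * p) k) => K1; last by apply: Rmult_le_pos => //; apply: pow2_ge_0.
      case: (Nat.ltb_spec k (n + n * p + n)) => K2; last by apply: Rmult_le_pos => //; apply: pow2_ge_0.
      cbv beta iota delta [andb].
      have -> : v = (1 + c) ^ (2 * p) * (norm (T (INR (p + 2)) x) ^ 2 / S0).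
      { rewrite /v. field. lra. }
      have Gw := weight_ge c n J ltac:(rewrite /c; lra) ltac:(lia) HJ p k ltac:(lia).
      apply: Rmult_le_compat.
      - apply: pow_le. rewrite /c. lra.
      - apply: Rdiv_le_0_compat => //. exact: pow2_ge_0.
      - rewrite Nat.mul_comm pow_mult. apply: pow_incr. split => //. apply: pow_le. rewrite /c. lra.
      - set t := INR k / INR n.
        have Et : t * INR n = INR k by rewrite /t; field; lra.
        have Ht0 : 0 <= t by apply: Rdiv_le_0_compat => //; apply: pos_INR.
        have [Ht1 Ht2] : INR (p + 1) <= t <= INR (p + 2).
        { have L1 : INR (n + n * p) <= INR k by apply: le_INR.
          have L2 : INR k <= INR (n + n * p + n) by apply: le_INR; lia.
          rewrite !plus_INR mult_INR in L1 L2. rewrite !plus_INR.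
          have -> : INR 1 = 1 by []. have -> : INR 2 = 2 by [].
          split; apply: (Rmult_le_reg_r (INR n)) => //; lra. }
        have Ep : INR (p + 2) = INR (p + 1) + 1 by rewrite !plus_INR /=; ring.
        have Tx : norm (T (INR (p + 2)) x) <= M * exp w * norm (T t x).
        { have -> : T (INR (p + 2)) x = T (INR (p + 2) - t) (T t x).
          { rewrite -(C0_add _ sg); [|lra|lra]. f_equal. ring. }
          apply: Rle_trans (growth _ _ _) _; first lra.
          apply: Rmult_le_compat_r; first exact: norm_ge_0.
          apply: Rmult_le_compat_l; first lra. apply: exp_le_compat.
          rewrite -[X in _ <= X]Rmult_1_r. apply: Rmult_le_compat_l; lra. }
        have Er : 1 <= exp (2 * alpha * INR (p + 2)) * (exp (- (alpha / INR n)) ^ k) ^ 2.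
        { rewrite exp_pow_nat exp_pow_nat -exp_plus -exp_0. apply: exp_le_compat.
          have -> : INR 2 * (INR k * - (alpha / INR n)) = - (2 * alpha * t).
          { rewrite /t /=. field. lra. }
          have := Rmult_le_compat_l (2 * alpha) _ _ ltac:(lra) Ht2. lra. }
        apply: (Rmult_le_reg_l S0) => //.
        have -> : S0 * (norm (T (INR (p + 2)) x) ^ 2 / S0) = norm (T (INR (p + 2)) x) ^ 2 by field; lra.
        have Tx2 : norm (T (INR (p + 2)) x) ^ 2 <= (M * exp w * norm (T t x)) ^ 2.
        { apply: pow_incr. split => //. exact: norm_ge_0. }
        apply: Rle_trans Tx2 _. rewrite (Rpow_mult_distr (M * exp w)).
        have P0 : 0 <= (M * exp w) ^ 2 * norm (T t x) ^ 2 by apply: Rmult_le_pos; exact: pow2_ge_0.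
        have := Rmult_le_compat_l _ _ _ P0 Er. rewrite /S0. lra. }
    set y := 2 * beta / INR n.
    have Py : 0 < y by apply: Rdiv_lt_0_compat; lra.
    have Eq : q = / exp y by rewrite -exp_Ropp.
    have Q1 : / (1 - q) <= INR n * (1 + / (2 * beta)).
    { have Ey := exp_ineq1_le y.
      have Q : q <= / (1 + y) by rewrite Eq; apply: Rinv_le_contravar; lra.
      have Q' : y / (1 + y) <= 1 - q.
      { have -> : y / (1 + y) = 1 - / (1 + y) by field; lra. lra. }
      have Pq : 0 < y / (1 + y) by apply: Rdiv_lt_0_compat; lra.
      apply: Rle_trans (Rinv_le_contravar _ _ Pq Q') _.
      have -> : / (y / (1 + y)) = 1 + INR n * / (2 * beta).
      { rewrite /y. field. repeat split; lra. }
      lra. }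
    have Q2 : q ^ S K <= / (beta ^ 2 * INR n ^ 2).
    { have Hs : exp (beta * INR n) ^ 2 <= / q ^ S K.
      { rewrite Eq pow_inv Rinv_inv !exp_pow_nat. apply: exp_le_compat.
        rewrite (S_INR K) /K mult_INR.
        have -> : (INR n * INR n + 1) * y = INR 2 * (beta * INR n) + y.
        { rewrite /y /=. field. lra. }
        lra. }
      have Pq : 0 < q ^ S K by apply: pow_lt; apply: exp_pos.
      rewrite -[X in X <= _]Rinv_inv. apply: Rinv_le_contravar.
      - apply: Rmult_lt_0_compat; apply: pow_lt; lra.
      - apply: Rle_trans Hs. rewrite -Rpow_mult_distr. apply: pow_incr.
        have := exp_ineq1_le (beta * INR n).
        have : 0 < beta * INR n by apply: Rmult_lt_0_compat. lra. }
    set e := norm (consistency_error n x) ^ 2. rewrite -/e in B.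
    have He : 0 <= e by exact: pow2_ge_0.
    set X := norm x ^ 2. rewrite -/X in B. have HX : 0 <= X by exact: pow2_ge_0.
    have -> : eta ^ 2 / 2 * (1 + c) ^ (2 * p) * norm (T (INR (p + 2)) x) ^ 2
      = S0 * (eta ^ 2 / 2 * v) by rewrite /v; field; lra.
    apply: Rmult_le_compat_l; first lra.
    apply: (Rmult_le_reg_l (INR n)) => //.
    have P1 : 0 <= 2 * Phi ^ 2 * M ^ 2 * e.
    { apply: Rmult_le_pos => //. apply: Rmult_le_pos; last exact: pow2_ge_0.
      apply: Rmult_le_pos; [lra | exact: pow2_ge_0]. }
    have P2 : 0 <= INR n ^ 2 * Phi ^ 2 * M ^ 2 * X.
    { do 3 (apply: Rmult_le_pos => //; try exact: pow2_ge_0). }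
    have P3 : 0 <= eta ^ 2 / 2 by have := pow2_ge_0 eta; lra.
    have B1 := Rmult_le_compat_l _ _ _ P3 low.
    have B2 := Rmult_le_compat_l _ _ _ P1 Q1.
    have B3 := Rmult_le_compat_l _ _ _ P2 Q2.
    have E3 : INR n ^ 2 * Phi ^ 2 * M ^ 2 * X * / (beta ^ 2 * INR n ^ 2)
      = INR n * (Phi ^ 2 * M ^ 2 * X * / beta ^ 2 * / INR n) by field; lra.
    rewrite E3 in B3. lra. }
  set C1 := S0 * (2 * Phi ^ 2 * M ^ 2 * (1 + / (2 * beta))).
  set C2 := S0 * (Phi ^ 2 * M ^ 2 * norm x ^ 2 * / beta ^ 2).
  have Ib : 0 < / (2 * beta) by apply: Rinv_0_lt_compat; lra.
  have Ib2 : 0 < / beta ^ 2 by apply: Rinv_0_lt_compat; apply: pow_lt.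
  have HC1 : 0 <= C1.
  { apply: Rmult_le_pos; first lra. apply: Rmult_le_pos; last lra.
    apply: Rmult_le_pos; last exact: pow2_ge_0. apply: Rmult_le_pos; [lra | exact: pow2_ge_0]. }
  have HC2 : 0 <= C2.
  { apply: Rmult_le_pos; first lra. apply: Rmult_le_pos; last lra.
    do 2 (apply: Rmult_le_pos; last exact: pow2_ge_0). exact: pow2_ge_0. }
  apply: le_epsilon => eps He.
  set d := Rmin 1 (eps / (2 * (C1 + 1))).
  have Hd : 0 < d by apply: Rmin_glb_lt; [lra | apply: Rdiv_lt_0_compat; lra].
  have [n0 Hn0] := consistency_error_cvg x d Hx Hd.
  have [n1 Hn1] := INR_unbounded (2 * C2 / eps).
  set n := (n0 + n1 + (p + 2))%nat.
  have Pn : 0 < INR n by apply: lt_0_INR; rewrite /n; lia.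
  have F := fixed n ltac:(rewrite /n; lia).
  have En := Hn0 n ltac:(rewrite /n; lia).
  have G1 : C1 * norm (consistency_error n x) ^ 2 <= eps / 2.
  { have D1 := Rmin_l 1 (eps / (2 * (C1 + 1))). have D2 := Rmin_r 1 (eps / (2 * (C1 + 1))).
    rewrite -/d in D1 D2. have N0 := norm_ge_0 (consistency_error n x).
    have S1 : norm (consistency_error n x) ^ 2 <= eps / (2 * (C1 + 1)) by nra.
    apply: Rle_trans (Rmult_le_compat_l _ _ _ HC1 S1) _.
    have -> : C1 * (eps / (2 * (C1 + 1))) = eps / 2 * (C1 / (C1 + 1)) by field; lra.
    have : C1 / (C1 + 1) <= 1.
    { apply: (Rmult_le_reg_r (C1 + 1)); first lra.
      have -> : C1 / (C1 + 1) * (C1 + 1) = C1 by field; lra. lra. }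
    have : 0 <= eps / 2 by lra. nra. }
  have G2 : C2 * / INR n <= eps / 2.
  { apply: (Rmult_le_reg_r (INR n)) => //.
    have -> : C2 * / INR n * INR n = C2 by field; lra.
    have L : 2 * C2 / eps <= INR n.
    { apply: Rle_trans (Rlt_le _ _ Hn1) _. apply: le_INR. rewrite /n. lia. }
    have He2 : 0 <= eps / 2 by lra.
    have := Rmult_le_compat_l _ _ _ He2 L.
    have -> : eps / 2 * (2 * C2 / eps) = C2 by field; lra. done. }
  rewrite /C1 in G1. rewrite /C2 in G2. apply: Rle_trans F _. rewrite /S0 in G1 G2 *. lra.
Qed.

End Energy.

(** * From a half-plane bound to exponential decay *)

Lemma bound_of_dense {H : HilbertSpace} (P : H -> Prop) (L : H -> H) (g : R) :
  is_linear L -> 0 <= g ->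
  (forall x eps, 0 < eps -> exists y, P y /\ norm (y - x)%V < eps) ->
  (forall y, P y -> norm (L y) <= g * norm y) ->
  forall x, norm (L x) <= g * norm x.
Proof.
  move=> HL Hg D B x. apply: le_epsilon => eps He.
  have [C [HC BC]] := linear_norm L HL.
  have [y [Py Hy]] := D x (eps / (g + C)) ltac:(apply: Rdiv_lt_0_compat; lra).
  have E : (x = y - (y - x))%V by vec_ring.
  have L1 : norm (L x) <= norm (L y) + norm (L (y - x)%V).
  { rewrite {1}E linear_sub // -[X in _ <= _ + X]norm_opp. exact: norm_plus_le. }
  have L2 : norm y <= norm x + norm (y - x)%V.
  { have {1}-> : (y = x + (y - x))%V by vec_ring. exact: norm_plus_le. }
  have := B y Py. have L3 : norm (L (y - x)%V) <= C * norm (y - x)%V := BC _.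
  have := Rmult_le_compat_l _ _ _ Hg L2.
  have : (g + C) * norm (y - x)%V <= (g + C) * (eps / (g + C)).
  { apply: Rmult_le_compat_l; lra. }
  have -> : (g + C) * (eps / (g + C)) = eps by field; lra.
  lra.
Qed.

Section Decay.
Context {H : HilbertSpace} (T : R -> H -> H) (sg : is_C0_semigroup T)
  (dom : H -> Prop) (A : H -> H) (gen : is_generator dom A T)
  (eta : R) (Heta : 0 < eta) (bound : half_plane_bound dom A eta).

(** The gain [ln (1 + eta / 2)] is the same for all rates [alpha], so that the
    lemma can be iterated as long as the rate is not negative. Integer times
    come from the bound on the domain by density; the constant [3 |mu|] pays
    for the passage to real times. *)
Lemma growth_rate_improvement (M w alpha : R) :
  1 <= M -> 0 <= w -> w < alpha -> exp_bound T M w ->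
  exists M', 1 <= M' /\ exp_bound T M' (alpha - ln (1 + eta / 2)).
Proof.
  move=> HM Hw Ha G.
  set mu := alpha - ln (1 + eta / 2).
  set D := 2 * M * (M * exp w) / eta.
  have Hc : 0 < 1 + eta / 2 by lra.
  have Ew := exp_pos w.
  have PMw : 0 < M * exp w by apply: Rmult_lt_0_compat; lra.
  have HD : 0 <= D.
  { apply: Rdiv_le_0_compat => //. apply: Rmult_le_pos; lra. }
  have int : forall p x, norm (T (INR (p + 2)) x) <= D * exp (2 * alpha) * exp (mu * INR p) * norm x.
  { move=> p. apply: (bound_of_dense dom).
    - apply: (semigroup_linear T sg). exact: pos_INR.
    - do 2 (apply: Rmult_le_pos; last by apply: Rlt_le; apply: exp_pos). done.
    - exact: (dom_dense T sg dom A gen).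
    - move=> y Hy.
      have B := damped_bound_on_domain T sg dom A gen eta Heta bound M w alpha HM Hw Ha G p y Hy.
      have Pc : 0 < (1 + eta / 2) ^ p by exact: pow_lt.
      have Ec : (1 + eta / 2) ^ p = exp (INR p * ln (1 + eta / 2)).
      { by rewrite -exp_pow_nat exp_ln. }
      have Em : exp (2 * alpha) * exp (mu * INR p) * (1 + eta / 2) ^ p = exp (alpha * INR (p + 2)).
      { rewrite Ec -!exp_plus. f_equal. rewrite plus_INR /mu /=. ring. }
      have Ea : exp (2 * alpha * INR (p + 2)) = exp (alpha * INR (p + 2)) ^ 2.
      { rewrite exp_pow_nat. f_equal. rewrite /=. ring. }
      rewrite Ea Nat.mul_comm pow_mult in B.
      have P1 : 0 < eta ^ 2 / 2 * ((1 + eta / 2) ^ p) ^ 2.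
      { apply: Rmult_lt_0_compat; last exact: pow_lt. have := pow_lt eta 2 Heta. lra. }
      apply: Rsqr_incr_0; [| exact: norm_ge_0 |]; last first.
      { apply: Rmult_le_pos; last exact: norm_ge_0.
        do 2 (apply: Rmult_le_pos; last by apply: Rlt_le; apply: exp_pos). done. }
      rewrite !Rsqr_pow2. apply: (Rmult_le_reg_l _ _ _ P1). apply: Rle_trans B _.
      apply: Req_le. rewrite -Em /D. field. lra. }
  have E3 := exp_pos (3 * Rabs mu). have E2 := exp_pos (2 * w). have EA := exp_pos (2 * alpha).
  have Ge1 : forall a, 0 <= a -> 1 <= exp a.
  { move=> a Hle. rewrite -exp_0. exact: exp_le_compat. }
  have G2 := Ge1 (2 * w) ltac:(lra).
  have G3 := Ge1 (3 * Rabs mu) ltac:(have := Rabs_pos mu; lra).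
  have shift : forall t s, 0 <= s <= 3 -> exp (mu * (t - s)) <= exp (3 * Rabs mu) * exp (mu * t).
  { move=> t s Hs. rewrite -exp_plus. apply: exp_le_compat.
    have := Rle_abs (- mu). rewrite Rabs_Ropp. have := Rabs_pos mu. nra. }
  have DA : 0 <= D * exp (2 * alpha) by apply: Rmult_le_pos; lra.
  have K1 : 1 <= M * exp (2 * w) by rewrite -[X in X <= _]Rmult_1_l; apply: Rmult_le_compat; lra.
  exists (M * exp (2 * w) * exp (3 * Rabs mu) * (1 + D * exp (2 * alpha))). split.
  { have : 1 <= M * exp (2 * w) * exp (3 * Rabs mu).
    { rewrite -[X in X <= _]Rmult_1_l. apply: Rmult_le_compat; lra. }
    move=> ?. rewrite -[X in X <= _]Rmult_1_l. apply: Rmult_le_compat; lra. }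
  move=> t x Ht. have Nx := norm_ge_0 x.
  have Et := exp_pos (mu * t).
  rewrite Rmult_assoc.
  set g := exp (mu * t) * norm x. have Hg : 0 <= g by apply: Rmult_le_pos; lra.
  case: (Rle_lt_dec 2 t) => Ht2.
  - have [p [Hp1 Hp2]] := nfloor_ex (t - 2) ltac:(lra).
    have E : INR (p + 2) = INR p + 2 by rewrite plus_INR.
    have -> : T t x = T (t - INR (p + 2)) (T (INR (p + 2)) x).
    { rewrite -(C0_add _ sg); [f_equal; ring | lra | exact: pos_INR]. }
    apply: Rle_trans (G _ _ _) _; first lra.
    have Sh := shift t (t - INR p) ltac:(lra).
    have ES : t - (t - INR p) = INR p by ring. rewrite ES in Sh.
    have S2 : exp (w * (t - INR (p + 2))) <= exp (2 * w).
    { apply: exp_le_compat. nra. }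
    have I := int p x.
    have I' : norm (T (INR (p + 2)) x) <= D * exp (2 * alpha) * (exp (3 * Rabs mu) * g).
    { apply: Rle_trans I _. rewrite Rmult_assoc. apply: Rmult_le_compat_l => //.
      rewrite /g -Rmult_assoc. exact: Rmult_le_compat_r. }
    have Q : 0 <= exp (3 * Rabs mu) * g by apply: Rmult_le_pos; lra.
    apply: (Rle_trans _ (M * exp (2 * w) * (D * exp (2 * alpha) * (exp (3 * Rabs mu) * g)))).
    + apply: Rmult_le_compat => //.
      * apply: Rmult_le_pos; [lra | apply: Rlt_le; exact: exp_pos].
      * exact: norm_ge_0.
      * apply: Rmult_le_compat_l; lra.
    + have : 0 <= M * exp (2 * w) * (exp (3 * Rabs mu) * g) by apply: Rmult_le_pos; lra.
      lra.
  - apply: Rle_trans (G _ _ Ht) _.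
    have Sh := shift t t ltac:(lra). rewrite Rminus_diag Rmult_0_r exp_0 in Sh.
    have S2 : exp (w * t) <= exp (2 * w) by apply: exp_le_compat; nra.
    have Q : norm x <= exp (3 * Rabs mu) * g.
    { rewrite /g -Rmult_assoc -[X in X <= _]Rmult_1_l. exact: Rmult_le_compat_r. }
    apply: (Rle_trans _ (M * exp (2 * w) * (exp (3 * Rabs mu) * g))).
    + apply: Rmult_le_compat => //.
      * apply: Rmult_le_pos; [lra | apply: Rlt_le; exact: exp_pos].
      * apply: Rmult_le_compat_l; lra.
    + have : 0 <= M * exp (2 * w) * (exp (3 * Rabs mu) * g) * (D * exp (2 * alpha)).
      { apply: Rmult_le_pos => //. apply: Rmult_le_pos; lra. }
      lra.
Qed.

(** Starting from any exponential bound, finitely many improvements by at least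
    [d] make the rate negative. *)
Theorem half_plane_bound_decay :
  exists M w, 1 <= M /\ w < 0 /\ exp_bound T M w.
Proof.
  set d := ln (1 + eta / 2) / 2.
  have Hd : 0 < d.
  { have : 0 < ln (1 + eta / 2) by rewrite -ln_1; apply: ln_increasing; lra.
    rewrite /d. lra. }
  have step : forall M w, 1 <= M -> exp_bound T M w ->
    exists M', 1 <= M' /\ exp_bound T M' (Rmax 0 w - d).
  { move=> M w HM G.
    have G0 : exp_bound T M (Rmax 0 w).
    { move=> t x Ht. apply: Rle_trans (G t x Ht) _.
      apply: Rmult_le_compat_r; first exact: norm_ge_0.
      apply: Rmult_le_compat_l; first lra. apply: exp_le_compat.
      have := Rmax_r 0 w. nra. }
    have [M' [HM' G']] := growth_rate_improvement M (Rmax 0 w) (Rmax 0 w + d) HM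
      (Rmax_l 0 w) ltac:(lra) G0.
    exists M'. split => //.
    have <- // : Rmax 0 w + d - ln (1 + eta / 2) = Rmax 0 w - d by rewrite /d; lra. }
  have iter : forall k : nat, forall M w, 1 <= M -> exp_bound T M w -> w <= INR k * d ->
    exists M', 1 <= M' /\ exp_bound T M' (- d).
  { elim=> [|k IH] M w HM G Hk; have [M' [HM' G']] := step M w HM G.
    - exists M'. split => //. rewrite /= Rmult_0_l in Hk.
      by rewrite Rmax_left // Rminus_0_l in G'.
    - apply: (IH M' _ HM' G'). rewrite S_INR in Hk.
      have Pk := pos_INR k.
      have : Rmax 0 w <= (INR k + 1) * d by apply: Rmax_lub; nra.
      lra. }
  have [M [w [HM [Hw G]]]] := semigroup_exp_bound T sg.
  have [k Hk] := INR_unbounded (w / d).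
  have [|M' [HM' G']] := iter k M w HM G.
  { have : w / d * d = w by field; lra. nra. }
  exists M', (- d). split => //. split => //. lra.
Qed.
End Decay.

(** * Growth bound and half-plane bound *)

Lemma op_norm_le_iff {H : HilbertSpace} (L : H -> H) (c : R) : is_linear L -> 0 <= c ->
  Rbar_le (op_norm L) c <-> forall x, norm (L x) <= c * norm x.
Proof.
  move=> HL Hc0. rewrite /op_norm.
  have [ub lub] := Lub_Rbar_correct (fun r => exists x : H, norm x <= 1 /\ r = norm (L x)).
  have L0 : norm (L vzero) = 0.
  { have -> : vzero = (RtoC 0 *: (vzero : H))%V by vec_ring.
    rewrite linear_mul // norm_scal_eq Cmod_0. ring. }
  split.
  - move=> Hc x.
    have U : forall y : H, norm y <= 1 -> norm (L y) <= c.
    { move=> y Hy. have : Rbar_le (norm (L y)) c; last done.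
      apply: Rbar_le_trans Hc. apply: ub. by exists y. }
    case: (Req_dec (norm x) 0) => Hx.
    + have -> : x = vzero := norm_eq_zero _ Hx. rewrite L0 norm_zero. lra.
    + have Px : 0 < norm x by have := norm_ge_0 x; lra.
      have Pi := Rinv_0_lt_compat _ Px.
      have N : norm (RtoC (/ norm x) *: x)%V <= 1.
      { rewrite norm_scal_eq Cmod_RtoC; last lra. apply: Req_le. by field. }
      have := U _ N. rewrite linear_mul // norm_scal_eq Cmod_RtoC; last lra.
      move=> /(Rmult_le_compat_r (norm x) _ _ (Rlt_le _ _ Px)).
      have -> // : / norm x * norm (L x) * norm x = norm (L x) by field.
  - move=> B. apply: lub => r [x [Hx ->]]. simpl.
    have := B x. nra.
Qed.

Lemma growth_bound_neg_iff {H : HilbertSpace} (T : R -> H -> H) : is_C0_semigroup T ->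
  Rbar_lt (growth_bound T) 0 <-> exists M w, 1 <= M /\ w < 0 /\ exp_bound T M w.
Proof.
  move=> sg. rewrite /growth_bound.
  set rates := fun w => exists M, 1 <= M /\ forall t, 0 <= t ->
    Rbar_le (op_norm (T t)) (M * exp (t * w)).
  have Hrates w : rates w <-> exists M, 1 <= M /\ exp_bound T M w.
  { have E t M : 0 <= t -> 1 <= M -> Rbar_le (op_norm (T t)) (M * exp (t * w)) <->
        forall x, norm (T t x) <= M * exp (w * t) * norm x.
    { move=> Ht HM. rewrite (Rmult_comm w). apply: op_norm_le_iff.
      - exact: semigroup_linear.
      - apply: Rmult_le_pos; [lra | apply: Rlt_le; exact: exp_pos]. }
    split; move=> [M [HM B]]; exists M; split => // t.
    - move=> x Ht. exact: (proj1 (E t M Ht HM) (B t Ht)).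
    - move=> Ht. apply: (proj2 (E t M Ht HM)) => x. exact: B. }
  have [lb glb] := Glb_Rbar_correct rates.
  split.
  - move=> N. apply: NNPP => K.
    have : Rbar_le 0 (Glb_Rbar rates).
    { apply: glb => w /Hrates [M [HM B]]. simpl. apply: Rnot_lt_le => Hw. apply: K.
      by exists M, w. }
    exact: Rbar_lt_not_le.
  - move=> [M [w [HM [Hw B]]]].
    apply: (Rbar_le_lt_trans _ w) => //. apply: lb. apply/Hrates. by exists M.
Qed.

(** The real part of the rank-one form [y |-> (y|x) ((A - lam) x|y)] is that of
    the form for [lam = 0] minus [Re lam |(y|x)|^2], hence still at most [- eta]
    at the given unit vector, while Cauchy-Schwarz bounds the modulus of the form
    by the norm of [(A - lam) x]. *)
Lemma half_plane_bound_of_numerical {H : HilbertSpace} (dom : H -> Prop) (A : H -> H)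
    (eta : R) : is_linear_on dom A ->
  (forall x : H, dom x -> norm x = 1 -> exists y : H, norm y = 1 /\
     Re (Cmult (inner y x) (inner (A x) y)) <= - eta) ->
  half_plane_bound dom A eta.
Proof.
  move=> lin num lam x Hl Hx.
  have unit : forall z, dom z -> norm z = 1 -> eta <= norm (lam *: z - A z)%V.
  { move=> z Hz Nz. have [y [Ny Hy]] := num z Hz Nz.
    have C1 := cauchy_schwarz y z. have C2 := cauchy_schwarz (A z - lam *: z)%V y.
    rewrite Ny Nz in C1. rewrite Ny norm_minus_sym Rmult_1_r in C2.
    have E : Re (Cmult (inner y z) (inner (A z - lam *: z)%V y))
      = Re (Cmult (inner y z) (inner (A z) y)) - Re lam * Cmod (inner y z) ^ 2.
    { rewrite inner_minus_l inner_scal_l (inner_conj _ y z).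
      rewrite /Cmod pow2_sqrt; last nra. rewrite /Re /=. ring. }
    have L := Rle_abs (- Re (Cmult (inner y z) (inner (A z - lam *: z)%V y))).
    rewrite Rabs_Ropp in L.
    have L2 := re_le_Cmod (Cmult (inner y z) (inner (A z - lam *: z)%V y)).
    rewrite Cmod_mult in L2.
    have P1 := Cmod_ge_0 (inner y z). have P2 := Cmod_ge_0 (inner (A z - lam *: z)%V y).
    have := Rmult_le_pos _ _ Hl (pow2_ge_0 (Cmod (inner y z))).
    have : Cmod (inner y z) * Cmod (inner (A z - lam *: z)%V y) <= Cmod (inner (A z - lam *: z)%V y).
    { rewrite -[X in _ <= X]Rmult_1_l. apply: Rmult_le_compat_r; lra. }
    lra. }
  case: (Req_dec (norm x) 0) => Nx; first by rewrite Nx Rmult_0_r; apply: norm_ge_0.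
  have Px : 0 < norm x by have := norm_ge_0 x; lra.
  have Pi := Rinv_0_lt_compat _ Px.
  have := unit (RtoC (/ norm x) *: x)%V (dom_scal _ _ lin _ _ Hx).
  rewrite (op_scal _ _ lin) //.
  have -> : (lam *: (RtoC (/ norm x) *: x) - RtoC (/ norm x) *: A x
    = RtoC (/ norm x) *: (lam *: x - A x))%V by vec_ring.
  rewrite !norm_scal_eq Cmod_RtoC; last lra. rewrite Rinv_l // => /(_ eq_refl) U.
  apply: (Rmult_le_reg_l (/ norm x)) => //.
  have -> // : / norm x * (eta * norm x) = eta by field.
Qed.

(** * From exponential decay to the numerical condition *)

Section Converse.
Context {H : HilbertSpace} (T : R -> H -> H) (sg : is_C0_semigroup T)
  (dom : H -> Prop) (A : H -> H) (gen : is_generator dom A T)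
  (M e : R) (HM : 1 <= M) (He : 0 < e) (decay : exp_bound T M (- e)).

(** The vector [x] is recovered from [x - z *: T h x], with
    [z = / (1 + lam * h)], by the Neumann series of [z *: T h], whose powers
    decay like [((1 + Re lam * h)^-1 * exp (- e h)) ^ k]. *)
Lemma discrete_resolvent_bound (lam : C) (h : R) (x : H) : 0 <= Re lam -> 0 < h ->
  (1 + Re lam * h - exp (- (e * h))) * norm x
  <= M * h * norm (lam *: x - diff_quotient T h x)%V.
Proof.
  move=> Hl Hh.
  set a := 1 + Re lam * h. set q := exp (- (e * h)) * / a.
  have Ha : 1 <= a by rewrite /a; have := Rmult_le_pos _ _ Hl (Rlt_le _ _ Hh); lra.
  have Eh : 0 < exp (- (e * h)) < 1.
  { split; first exact: exp_pos. rewrite -exp_0. apply: exp_increasing.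
    have := Rmult_lt_0_compat _ _ He Hh. lra. }
  have Ia : 0 < / a <= 1.
  { split; first by apply: Rinv_0_lt_compat; lra. rewrite -Rinv_1. apply: Rinv_le_contravar; lra. }
  have Hq : 0 < q < 1.
  { split; first by apply: Rmult_lt_0_compat; lra.
    have := Rmult_le_compat_l _ _ _ (Rlt_le _ _ (proj1 Eh)) (proj2 Ia). rewrite /q. lra. }
  set s := Cplus (RtoC 1) (Cmult lam (RtoC h)).
  have Res : Re s = a by rewrite /s /a /Re /=; ring.
  have Ms : a <= Cmod s.
  { rewrite -Res. apply: Rle_trans (Rle_abs _) (re_le_Cmod s). }
  have s0 : s <> RtoC 0.
  { move=> E. rewrite E Cmod_0 in Ms. lra. }
  set z := Cinv s.
  have Mz : Cmod z <= / a.
  { rewrite /z Cmod_inv //. apply: Rinv_le_contravar; lra. }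
  have Mz0 := Cmod_ge_0 z.
  have Lh : is_linear (T h) by apply: (semigroup_linear T sg); lra.
  have power : forall k y, norm (Cpow z k *: T (INR k * h) y)%V <= M * q ^ k * norm y.
  { move=> k y. have Pk := pos_INR k.
    have Pt : 0 <= INR k * h by apply: Rmult_le_pos; lra.
    rewrite norm_scal_eq Cmod_pow.
    have G := decay (INR k * h) y Pt.
    have -> : q ^ k = exp (- e * (INR k * h)) * (/ a) ^ k.
    { rewrite /q Rpow_mult_distr exp_pow_nat. do 2 f_equal. ring. }
    have -> : M * (exp (- e * (INR k * h)) * (/ a) ^ k) * norm y
      = (/ a) ^ k * (M * exp (- e * (INR k * h)) * norm y) by ring.
    apply: Rmult_le_compat => //; [by apply: pow_le | exact: norm_ge_0 | by apply: pow_incr]. }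
  set d := norm (x - z *: T h x)%V.
  have tele : forall N, norm (x - Cpow z N *: T (INR N * h) x)%V * (1 - q) <= M * d * (1 - q ^ N).
  { elim=> [|N IH].
    - rewrite /= Rmult_0_l (C0_zero _ sg).
      have -> : (x - RtoC 1 *: x = vzero)%V by vec_ring. rewrite norm_zero. lra.
    - have PN := pos_INR N. have PNh : 0 <= INR N * h by apply: Rmult_le_pos; lra.
      have LN : is_linear (T (INR N * h)) by apply: (semigroup_linear T sg).
      have E : (x - Cpow z (S N) *: T (INR (S N) * h) x
        = (x - Cpow z N *: T (INR N * h) x) + Cpow z N *: T (INR N * h) (x - z *: T h x))%V.
      { have -> : INR (S N) * h = INR N * h + h by rewrite S_INR; ring.
        rewrite (C0_add _ sg) //; last lra.
        rewrite (linear_sub (T (INR N * h))) // (linear_mul (T (INR N * h))) //. rewrite Cpow_S. vec_ring. }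
      rewrite E.
      have B := norm_plus_le (x - Cpow z N *: T (INR N * h) x)%V
        (Cpow z N *: T (INR N * h) (x - z *: T h x))%V.
      have P := power N (x - z *: T h x)%V. rewrite -/d in P.
      have := Rmult_le_compat_r (1 - q) _ _ ltac:(lra) B.
      have := Rmult_le_compat_r (1 - q) _ _ ltac:(lra) P.
      rewrite -(tech_pow_Rmult q N). lra. }
  have d0 : 0 <= d by exact: norm_ge_0.
  have main : norm x * (1 - q) <= M * d.
  { apply: le_epsilon => eps Heps.
    have Nx := norm_ge_0 x.
    have [N HN] := pow_lt_1_zero q ltac:(rewrite Rabs_pos_eq; lra)
      (eps / (M * norm x + 1)) ltac:(apply: Rdiv_lt_0_compat => //; nra).
    have := HN N (le_n N). have PqN : 0 < q ^ N by apply: pow_lt; lra.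
    rewrite Rabs_pos_eq; last lra. move=> QN.
    have T1 := tele N. have T2 := power N x.
    have T3 : norm x <= norm (x - Cpow z N *: T (INR N * h) x)%V + norm (Cpow z N *: T (INR N * h) x)%V.
    { have {1}-> : (x = (x - Cpow z N *: T (INR N * h) x) + Cpow z N *: T (INR N * h) x)%V by vec_ring.
      exact: norm_plus_le. }
    have T4 : M * q ^ N * norm x <= eps.
    { have PM : 0 <= M * norm x by apply: Rmult_le_pos; lra.
      have := Rmult_le_compat_r (M * norm x + 1) _ _ ltac:(lra) (Rlt_le _ _ QN).
      have -> : eps / (M * norm x + 1) * (M * norm x + 1) = eps by field; lra.
      lra. }
    have T5 := Rmult_le_compat_r (1 - q) _ _ ltac:(lra) T3.
    have Md : 0 <= M * d by apply: Rmult_le_pos; lra.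
    have T6 : M * d * (1 - q ^ N) <= M * d by have := Rmult_le_pos _ _ Md (Rlt_le _ _ PqN); lra.
    have T7 : norm (Cpow z N *: T (INR N * h) x)%V * (1 - q) <= eps.
    { have N0 := norm_ge_0 (Cpow z N *: T (INR N * h) x)%V. nra. }
    lra. }
  have Ed : d <= / a * (h * norm (lam *: x - diff_quotient T h x)%V).
  { rewrite /d.
    have -> : (x - z *: T h x = (z * RtoC h) *: (lam *: x - diff_quotient T h x))%V.
    { rewrite /diff_quotient RtoC_inv; last lra. rewrite /z /s in s0 *.
      vec_field. split => //. move=> [E]. lra. }
    rewrite norm_scal_eq Cmod_mult (Cmod_RtoC h); last lra. rewrite Rmult_assoc.
    apply: Rmult_le_compat_r => //. apply: Rmult_le_pos; [lra | exact: norm_ge_0]. }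
  have Eq : 1 + Re lam * h - exp (- (e * h)) = a * (1 - q) by rewrite /q -/a; field; lra.
  rewrite Eq.
  have S1 := Rmult_le_compat_l a _ _ ltac:(lra) main.
  have S2 := Rmult_le_compat_l (a * M) _ _ ltac:(nra) Ed.
  have S3 : a * M * (/ a * (h * norm (lam *: x - diff_quotient T h x)%V))
    = M * h * norm (lam *: x - diff_quotient T h x)%V by field; lra.
  lra.
Qed.

(** Not only a uniform bound: the growth in [Re lam] is needed for vectors [x]
    with large [Re (A x|x)]. *)
Lemma resolvent_bound_of_decay (lam : C) (x : H) : 0 <= Re lam -> dom x ->
  (Re lam + e / 2) * norm x <= M * norm (lam *: x - A x)%V.
Proof.
  move=> Hl Hx. apply: le_epsilon => eps Heps.
  have [d [Hd K]] := proj1 (generator_graph_iff T x (A x))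
    (generator_val _ _ _ gen x Hx) (eps / M) ltac:(apply: Rdiv_lt_0_compat; lra).
  have Ie : 0 < / e by exact: Rinv_0_lt_compat.
  have Hm : 0 < Rmin d (/ e) by apply: Rmin_glb_lt.
  have L1 := Rmin_l d (/ e). have L2 := Rmin_r d (/ e).
  set h := Rmin d (/ e) / 2. have Hh : 0 < h by rewrite /h; lra.
  have Heh : 0 < e * h <= 1.
  { split; first exact: Rmult_lt_0_compat.
    have : e * h <= e * / e by apply: Rmult_le_compat_l; rewrite /h; lra.
    rewrite Rinv_r; lra. }
  have B := discrete_resolvent_bound lam h x Hl Hh.
  (* [exp (- y) <= / (1 + y) <= 1 - y / 2] for [0 < y <= 1] *)
  have E : e / 2 * h <= 1 - exp (- (e * h)).
  { rewrite exp_Ropp. have Ey := exp_ineq1_le (e * h).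
    have I : / exp (e * h) <= / (1 + e * h) by apply: Rinv_le_contravar; lra.
    have : / (1 + e * h) <= 1 - e * h / 2; last lra.
    apply: (Rmult_le_reg_l (1 + e * h)); first lra. rewrite Rinv_r; nra. }
  have Nx := norm_ge_0 x.
  have C1 : h * ((Re lam + e / 2) * norm x) <= M * h * norm (lam *: x - diff_quotient T h x)%V.
  { apply: Rle_trans B. have := Rmult_le_compat_r _ _ _ Nx E. lra. }
  have C2 : (Re lam + e / 2) * norm x <= M * norm (lam *: x - diff_quotient T h x)%V.
  { apply: (Rmult_le_reg_l h) => //. lra. }
  have D := norm_minus_triangle (lam *: x)%V (A x) (diff_quotient T h x).
  have Kh := K h ltac:(rewrite /h; lra). rewrite norm_minus_sym in Kh.
  have := Rmult_le_compat_l M _ _ ltac:(lra) D.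
  have := Rmult_le_compat_l M _ _ ltac:(lra) (Rlt_le _ _ Kh).
  have -> : M * (eps / M) = eps by field; lra. lra.
Qed.

(** Let [a = A x - i Im (A x|x) x]. The form [y |-> Re ((y|x) (A x|y))] is that
    of a self-adjoint operator of rank at most two, whose eigenvalues on the span
    of [x] and [a] are [(Re (A x|x) + |a|) / 2] and [(Re (A x|x) - |a|) / 2]; the
    vector [a - |a| x] belongs to the second one. The resolvent bound at
    [lam = (A x|x)], or at [lam = i Im (A x|x)] if [Re (A x|x)] is negative, keeps
    this eigenvalue away from 0. *)
Lemma numerical_of_decay :
  forall x, dom x -> norm x = 1 -> exists y : H, norm y = 1 /\
    Re (Cmult (inner y x) (inner (A x) y)) <= - (e / (4 * M ^ 2)).
Proof.
  move=> x Hx Nx.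
  set r := Re (inner (A x) x). set t := Im (inner (A x) x).
  have Exx : inner x x = RtoC 1 by rewrite inner_norm Nx pow1.
  have EA : inner (A x) x = (r, t) by rewrite /r /t; case: (inner (A x) x).
  have EA' : inner x (A x) = (r, - t) by rewrite inner_conj EA.
  have [a Ea] : exists a : H, a = (A x - (0, t) *: x)%V by eexists.
  set rho := norm a.
  have Eax : inner a x = RtoC r.
  { rewrite Ea inner_minus_l inner_scal_l EA Exx. apply: injective_projections; rewrite /=; ring. }
  have Exa : inner x a = RtoC r.
  { rewrite inner_conj Eax. apply: injective_projections; rewrite /=; ring. }
  have Eaa : inner a a = RtoC (rho ^ 2) by rewrite inner_norm.
  have Hrho : 0 <= rho by exact: norm_ge_0.
  have PM2 : 1 <= M ^ 2 by rewrite -(pow1 2); apply: pow_incr; lra.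
  set kappa := e / 2 / M ^ 2.
  have Hk : 0 < kappa by apply: Rdiv_lt_0_compat; lra.
  have EkM : kappa * M ^ 2 = e / 2 by rewrite /kappa; field; lra.
  have gap : kappa <= rho - r.
  { case: (Rle_lt_dec 0 r) => Hr.
    - have B := resolvent_bound_of_decay (r, t) x Hr Hx.
      have E : norm ((r, t) *: x - A x)%V ^ 2 = rho ^ 2 - r ^ 2.
      { have -> : ((r, t) *: x - A x = RtoC r *: x - a)%V.
        { rewrite Ea. apply: inner_ext => z. expand_inner. rewrite /RtoC.
          apply: injective_projections; rewrite /=; ring. }
        rewrite norm_sqr_inner. expand_inner. rewrite Exx Eax Exa Eaa /Re /=. ring. }
      rewrite Nx Rmult_1_r /= -/r in B.
      have B2 : (r + e / 2) ^ 2 <= M ^ 2 * (rho ^ 2 - r ^ 2).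
      { rewrite -E -Rpow_mult_distr. apply: pow_incr. split => //. lra. }
      (* otherwise [rho ^ 2 - r ^ 2] would be below [(2 r + kappa) kappa] *)
      apply: Rnot_lt_le => L.
      have U : rho ^ 2 - r ^ 2 < kappa * (2 * r + kappa) by nra.
      have U2 : M ^ 2 * (rho ^ 2 - r ^ 2) < M ^ 2 * (kappa * (2 * r + kappa)).
      { apply: Rmult_lt_compat_l; lra. }
      have : kappa <= e / 2 by nra.
      nra.
    - have B := resolvent_bound_of_decay (0, t) x (Rle_refl 0) Hx.
      rewrite norm_minus_sym -Ea -/rho Nx /= in B.
      have : kappa <= rho.
      { apply: (Rmult_le_reg_l (M ^ 2)); first lra. rewrite (Rmult_comm (M ^ 2)) EkM. nra. }
      lra. }
  have cs : - r <= rho.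
  { have := re_inner_le (- a)%V x. rewrite inner_opp_l Eax [norm (- a)%V]norm_opp Nx /Re /= -/rho. lra. }
  have Prho : 0 < rho.
  { case: (Req_dec rho 0) => E; lra. }
  set y0 := (a - RtoC rho *: x)%V.
  have Ey : norm y0 ^ 2 = 2 * rho * (rho - r).
  { rewrite norm_sqr_inner /y0. expand_inner. rewrite Exx Eax Exa Eaa /Re /=. ring. }
  have Py : 0 < norm y0.
  { have : 0 < norm y0 ^ 2 by rewrite Ey; apply: Rmult_lt_0_compat; lra.
    have := norm_ge_0 y0. nra. }
  have Pi : 0 < / norm y0 by exact: Rinv_0_lt_compat.
  exists (RtoC (/ norm y0) *: y0)%V. split.
  { rewrite norm_scal_eq Cmod_RtoC; last lra. apply: Rinv_l. lra. }
  have Eyx : inner y0 x = RtoC (r - rho).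
  { rewrite /y0 inner_minus_l inner_scal_l Eax Exx. apply: injective_projections; rewrite /=; ring. }
  have Exy : inner x y0 = RtoC (r - rho).
  { rewrite inner_conj Eyx. apply: injective_projections; rewrite /=; ring. }
  have Eay : inner a y0 = RtoC (rho ^ 2 - rho * r).
  { rewrite /y0. expand_inner. rewrite Eaa Eax. apply: injective_projections; rewrite /=; ring. }
  have EAy : inner (A x) y0 = Cplus (RtoC (rho ^ 2 - rho * r)) (Cmult (0, t) (RtoC (r - rho))).
  { have -> : (A x = a + (0, t) *: x)%V by rewrite Ea; vec_ring.
    by rewrite inner_plus_l inner_scal_l Eay Exy. }
  rewrite inner_scal_l inner_scal_r Eyx EAy.
  have -> : Re (Cmult (Cmult (RtoC (/ norm y0)) (RtoC (r - rho))) (Cmult (Cconj (RtoC (/ norm y0)))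
     (Cplus (RtoC (rho ^ 2 - rho * r)) (Cmult (0, t) (RtoC (r - rho))))))
    = / norm y0 ^ 2 * ((r - rho) * (rho ^ 2 - rho * r)).
  { rewrite /Re /=. field. lra. }
  rewrite Ey.
  have -> : / (2 * rho * (rho - r)) * ((r - rho) * (rho ^ 2 - rho * r)) = - ((rho - r) / 2).
  { field. lra. }
  have -> : e / (4 * M ^ 2) = kappa / 2 by rewrite /kappa; field; lra.
  lra.
Qed.

End Converse.

Theorem theoremA1 (H : HilbertSpace) (dom : H -> Prop) (A : H -> H)
    (T : R -> H -> H) (hT : is_C0_semigroup T) (hA : is_generator dom A T) :
  Rbar_lt (growth_bound T) 0 <->
  exists eta : R, 0 < eta /\
    forall x : H, dom x -> norm x = 1 ->
      exists y : H, norm y = 1 /\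
        Re (Cmult (inner y x) (inner (A x) y)) <= - eta.
Proof.
  rewrite growth_bound_neg_iff //. split.
  - move=> [M [w [HM [Hw B]]]]. exists (- w / (4 * M ^ 2)). split.
    + apply: Rdiv_lt_0_compat; first lra. have := pow_lt M 2 ltac:(lra). lra.
    + apply: (numerical_of_decay T hT dom A hA M (- w) HM); first lra.
      by rewrite Ropp_involutive.
  - move=> [eta [Heta N]].
    apply: (half_plane_bound_decay T hT dom A hA eta Heta).
    exact: half_plane_bound_of_numerical (generator_is_linear T hT dom A hA) N.
Qed.
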